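(* Let $f\in\mathcal B$ be not an extreme point of $\mathcal B$, and let $A_n,B_n$ be its Schur polynomials. Then there exist analytic functions $a,b$ on $\mathbb D$ such that $A_n\to a$ and $B_n\to b$ uniformly on compact subsets of $\mathbb D$ as $n\to\infty$, and $a=bf$. Moreover $A_n^*\to0$ and $B_n^*\to0$ uniformly on compact subsets of $\mathbb D$.
   Context: $\mathbb D=\{|z|<1\}$; $\mathcal B$ is the set of analytic $f$ on $\mathbb D$ with $|f|<1$ on $\mathbb D$. An element $f\in\mathcal B$ is an extreme point of $\mathcal B$ if it is not a proper convex combination $tg+(1-t)h$, $0<t<1$, of two distinct $g,h\in\mathcal B$. (A non-extreme $f$ is not a finite Blaschke product, so the Schur algorithm below never terminates.) For a polynomial $p$ indexed by $n$, $p^*(z)=z^n\overline{p(1/\bar z)}$ (reversal with respect to degree $n$). Schur algorithm: $f_0=f$, $\gamma_n=f_n(0)$, $f_{n+1}(z)=\frac1z\frac{f_n(z)-\gamma_n}{1-\overline{\gamma_n}f_n(z)}$. Schur polynomials: $A_0=\gamma_0$, $B_0=1$, and for $n\ge1$, $A_n=A_{n-1}+z\gamma_nB_{n-1}^*$, $B_n=B_{n-1}+z\gamma_nA_{n-1}^*$. *)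

(* Defs.v *)
From Stdlib Require Import Reals List.
From Coquelicot Require Import Coquelicot.
Open Scope R_scope.

Definition inD (z : C) : Prop := Cmod z < 1.

Definition analytic_on_D (f : C -> C) : Prop :=
  forall z : C, inD z -> ex_derive f z.

Definition in_B (f : C -> C) : Prop :=
  analytic_on_D f /\ forall z : C, inD z -> Cmod (f z) < 1.

Definition extreme_B (f : C -> C) : Prop :=
  in_B f /\
  ~ (exists (t : R) (g h : C -> C),
        0 < t < 1 /\ in_B g /\ in_B h /\
        (exists z : C, inD z /\ g z <> h z) /\
        (forall z : C, inD z ->
            f z = Cplus (Cmult (RtoC t) (g z)) (Cmult (RtoC (1 - t)) (h z)))).

(* One step of the Schur algorithm:
   f_{n+1}(z) = (1/z) (f_n(z) - g)/(1 - conj(g) f_n(z)),  g = f_n(0),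
   with the removable singularity at 0 filled in by its limit
   f_n'(0) / (1 - |g|^2). *)
Definition schur_step (fn : C -> C) : C -> C :=
  let g := fn (RtoC 0) in
  fun z =>
    if Ceq_dec z (RtoC 0) then
      Cdiv (C_derive fn (RtoC 0)) (Cminus (RtoC 1) (Cmult (Cconj g) g))
    else
      Cmult (Cinv z)
        (Cdiv (Cminus (fn z) g) (Cminus (RtoC 1) (Cmult (Cconj g) (fn z)))).

Fixpoint schur_iter (f : C -> C) (n : nat) : C -> C :=
  match n with
  | O => f
  | S m => schur_step (schur_iter f m)
  end.

Definition schur_gamma (f : C -> C) (n : nat) : C := schur_iter f n (RtoC 0).

(* Coefficients of the Schur polynomials (A_n, B_n), A_n, B_n of degree <= n:
   A_0 = gamma_0, B_0 = 1,
   A_n = A_{n-1} + z gamma_n B_{n-1}^*,  B_n = B_{n-1} + z gamma_n A_{n-1}^*,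
   where p^* is the reversal of p w.r.t. degree n-1, whose k-th coefficient is
   conj (p_{n-1-k}) for k <= n-1 (and 0 otherwise). Hence the k-th coefficient
   of z p^* is conj(p_{n-k}) for 1 <= k <= n, and 0 otherwise. *)
Fixpoint schur_coefs (f : C -> C) (n : nat) : (nat -> C) * (nat -> C) :=
  match n with
  | O => (fun k => match k with O => schur_gamma f 0 | _ => RtoC 0 end,
          fun k => match k with O => RtoC 1 | _ => RtoC 0 end)
  | S m =>
      let '(a, b) := schur_coefs f m in
      let g := schur_gamma f (S m) in
      (fun k => match k with
                | O => a O
                | S _ => if Nat.leb k (S m)
                         then Cplus (a k) (Cmult g (Cconj (b (S m - k)%nat)))
                         else a k
                end,
       fun k => match k with
                | O => b O
                | S _ => if Nat.leb k (S m)
                         then Cplus (b k) (Cmult g (Cconj (a (S m - k)%nat)))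
                         else b k
                end)
  end.

Definition poly_eval (c : nat -> C) (n : nat) (z : C) : C :=
  sum_n (fun k => Cmult (c k) (pow_n z k)) n.

(* Evaluation of the reversed polynomial p^*(z) = z^n conj(p(1/conj z)),
   i.e. coefficients conj(c_{n-k}), k = 0..n. *)
Definition poly_eval_star (c : nat -> C) (n : nat) (z : C) : C :=
  sum_n (fun k => Cmult (Cconj (c (n - k)%nat)) (pow_n z k)) n.

Definition schurA (f : C -> C) (n : nat) : C -> C :=
  poly_eval (fst (schur_coefs f n)) n.
Definition schurB (f : C -> C) (n : nat) : C -> C :=
  poly_eval (snd (schur_coefs f n)) n.
Definition schurA_star (f : C -> C) (n : nat) : C -> C :=
  poly_eval_star (fst (schur_coefs f n)) n.
Definition schurB_star (f : C -> C) (n : nat) : C -> C :=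
  poly_eval_star (snd (schur_coefs f n)) n.

Definition open_C (U : C -> Prop) : Prop :=
  forall z, U z -> exists eps : R, 0 < eps /\
    forall w, Cmod (Cminus w z) < eps -> U w.

Definition compact_C (K : C -> Prop) : Prop :=
  forall (I : Type) (U : I -> C -> Prop),
    (forall i, open_C (U i)) ->
    (forall z, K z -> exists i, U i z) ->
    exists l : list I, forall z, K z -> exists i, In i l /\ U i z.

Definition unif_cvg_on (K : C -> Prop) (F : nat -> C -> C) (g : C -> C) : Prop :=
  forall eps : R, 0 < eps -> exists N : nat, forall n : nat, (N <= n)%nat ->
    forall z, K z -> Cmod (Cminus (F n z) (g z)) < eps.

Definition loc_unif_cvg_D (F : nat -> C -> C) (g : C -> C) : Prop :=
  forall K : C -> Prop, compact_C K -> (forall z, K z -> inD z) ->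
    unif_cvg_on K F g.

(* Main.v *)
Require Import Defs.
From Stdlib Require Import Reals List Lra Lia Classical_Prop ClassicalEpsilon.
From Coquelicot Require Import Coquelicot.
Open Scope R_scope.

(* A non-extreme f admits an analytic U, not identically 0, with |f|^2 + |U|^2 <= 1: take U
   proportional to g - h where f = t g + (1-t) h.  Such a companion is inherited by the Schur
   iterates, U_{n+1} = U_n sqrt(1 - |gamma_n|^2) / (1 - conj gamma_n f_n), through Schwarz's lemma
   for the pair (f_n, U_n).  At a point z0 with U(z0) <> 0 the ratio |U_n|^2 / (1 - |f_n|^2) stays
   below 1 and grows by at least a constant times |f_{n+1}(z0)|^2, so sum |f_n(z0)|^2, and with it
   sum |gamma_n|^2, is finite.  On |z| <= r < 1 both (A_n, B_n^* ) and (B_n, A_n^* ) satisfy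
   X' = X + z gamma Y, Y' = z Y + conj gamma X; the energy |X|^2 + |Y|^2 grows at most by the factor
   1 + C |gamma|^2 and dissipates (1 - r^2)/2 |Y|^2, whence sum |Y|^2 < oo, X converges and Y -> 0.
   Finally f B_n - A_n = z f_{n+1} (B_n^* - f A_n^* ) -> 0 gives a = b f.
   The function theory (Cauchy's formula for functions that are only assumed complex
   differentiable) comes from Goursat's argument applied to h o exp on a rectangle of height
   2 pi, which says that circle means of h do not depend on the radius. *)

(** * Continuity and complex differentiability *)

(** Extremality is classically tested by the logarithmic integral of $1-|f|$ over the unit circle;
    the companion [U] takes its place, so no boundary values occur. It works because of Pick's
    identity: one Schur step multiplies $|U_n|^2$ and $1-|f_n|^2$ by the same factor, but turns the
    latter into $1-|zf_{n+1}|^2$. The growth of the ratio is the gap between $|zf_{n+1}|$ and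
    $|f_{n+1}|$. The base point is [z0] and not 0 because [U] may vanish at 0; the Schur step at
    [z0] then expresses gamma_n through $f_n(z_0)$ and $f_{n+1}(z_0)$. The obstacle in the recursion
    is a circle: X converges if Y is square-summable, while Y is driven by X. The energy breaks it,
    since the factor z in front of Y loses a fixed share on $|z|\le r$. Each Schur iterate is a
    quotient with a hole at 0. Cauchy's formula is therefore proved at once for functions
    holomorphic off 0 and continuous at 0: circles centred at 0 never meet the exceptional point, so
    removable singularities come with it. *)

Lemma Cmod_sub_sym (x y : C) : Cmod (x - y) = Cmod (y - x).
Proof. rewrite <- Cmod_opp; f_equal; ring. Qed.

Lemma Cmod_sub_triangle (x y z : C) : Cmod (x - z) <= Cmod (x - y) + Cmod (y - z).
Proof. replace (x - z)%C with ((x - y) + (y - z))%C by ring. apply Cmod_triangle. Qed.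

Lemma Cmod_sub_ge (x y : C) : Cmod x - Cmod y <= Cmod (x - y).
Proof.
  assert (H := Cmod_triangle (x - y) y).
  replace (x - y + y)%C with x in H by ring. lra.
Qed.

Lemma Cmod_sub_le (x y : C) : Cmod (x - y) <= Cmod x + Cmod y.
Proof. rewrite <- (Cmod_opp y). apply Cmod_triangle. Qed.

Lemma Cmod_ne0 (x : C) : 0 < Cmod x -> x <> RtoC 0.
Proof. intros H ->. rewrite Cmod_0 in H. lra. Qed.

Lemma RtoC_ne0 (x : R) : x <> 0 -> RtoC x <> RtoC 0.
Proof. intros H E. apply H. exact (RtoC_inj _ _ E). Qed.

Lemma Csub_ne0 (x y : C) : Cmod y < Cmod x -> (x - y)%C <> RtoC 0.
Proof. intros H. apply Cmod_ne0. assert (K := Cmod_sub_ge x y). lra. Qed.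

(** The source is any uniform space, so that the same rules serve functions of a complex variable,
    paths on [R] and maps of two real parameters. For complex sources [Cspace] below fixes the
    uniform structure whose balls are the discs of [Cmod], the one behind [ex_derive] in
    [analytic_on_D]. *)
Definition ccont {U : UniformSpace} (f : U -> C) (x : U) :=
  forall eps, 0 < eps -> locally x (fun y => Cmod (f y - f x) < eps).

Notation Cspace := (AbsRing_UniformSpace C_AbsRing).

Lemma locally_Cmod (z : C) (P : C -> Prop) :
  @locally Cspace z P <->
  exists d, 0 < d /\ forall w, Cmod (w - z) < d -> P w.
Proof.
  split.
  - intros [d H]. exists d. split; [apply cond_pos|]. intros w Hw. apply H. exact Hw.
  - intros (d & Hd & H). exists (mkposreal d Hd). intros w Hw. apply H. exact Hw.
Qed.

Section Continuity.
Context {U : UniformSpace}.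
Implicit Types (f g : U -> C) (x : U).

Lemma ccont_const (c : C) x : ccont (fun _ => c) x.
Proof.
  intros e He. apply filter_forall. intros y.
  replace (c - c)%C with (RtoC 0) by ring. now rewrite Cmod_0.
Qed.

Lemma ccont_ext f g x : (forall y, f y = g y) -> ccont f x -> ccont g x.
Proof.
  intros H Hf e He. generalize (Hf e He). apply filter_imp. intros y. now rewrite !H.
Qed.

Lemma ccont_ext_loc f g x : locally x (fun y => f y = g y) -> ccont f x -> ccont g x.
Proof.
  intros H Hf e He. generalize (@filter_and _ (locally x) _ _ _ H (Hf e He)). apply filter_imp.
  intros y [E]. now rewrite <- E, <- (locally_singleton _ _ H).
Qed.

Lemma ccont_plus f g x : ccont f x -> ccont g x -> ccont (fun y => f y + g y)%C x.
Proof.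
  intros Hf Hg e He.
  generalize (@filter_and _ (locally x) _ _ _ (Hf (e/2) ltac:(lra)) (Hg (e/2) ltac:(lra))).
  apply filter_imp. intros y [H1 H2].
  replace (f y + g y - (f x + g x))%C with ((f y - f x) + (g y - g x))%C by ring.
  eapply Rle_lt_trans; [apply Cmod_triangle|lra].
Qed.

Lemma ccont_mult f g x : ccont f x -> ccont g x -> ccont (fun y => f y * g y)%C x.
Proof.
  intros Hf Hg e He.
  set (M := Cmod (f x) + Cmod (g x) + 1).
  assert (HM : 0 < M).
  { unfold M. generalize (Cmod_ge_0 (f x)) (Cmod_ge_0 (g x)); lra. }
  set (d := Rmin 1 (e / (2 * M))).
  assert (Hd : 0 < d).
  { unfold d. apply Rmin_pos; [lra|]. apply Rdiv_lt_0_compat; lra. }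
  generalize (@filter_and _ (locally x) _ _ _ (Hf d Hd) (Hg d Hd)).
  apply filter_imp. intros y [H1 H2].
  replace (f y * g y - f x * g x)%C with ((f y - f x) * (g y - g x) + ((f y - f x) * g x + f x * (g y - g x)))%C by ring.
  assert (D1 : d <= 1) by apply Rmin_l.
  assert (D2 : d * M <= e / 2).
  { replace (e / 2) with (e / (2 * M) * M) by (field; lra).
    apply Rmult_le_compat_r; [lra|apply Rmin_r]. }
  eapply Rle_lt_trans; [apply Cmod_triangle|].
  assert (T := Cmod_triangle ((f y - f x) * g x) (f x * (g y - g x))).
  rewrite !Cmod_mult in *.
  assert (P1 := Cmod_ge_0 (f y - f x)). assert (P2 := Cmod_ge_0 (g y - g x)).
  assert (P3 := Cmod_ge_0 (f x)). assert (P4 := Cmod_ge_0 (g x)).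
  assert (Cmod (f y - f x) * Cmod (g y - g x) <= d) by nra.
  unfold M in D2. nra.
Qed.

Lemma ccont_inv f x : f x <> RtoC 0 -> ccont f x -> ccont (fun y => / f y)%C x.
Proof.
  intros Hx Hf e He.
  assert (P : 0 < Cmod (f x)) by now apply Cmod_gt_0.
  set (m := Cmod (f x)) in *.
  set (d := Rmin (m / 2) (e * m * m / 4)).
  assert (Hd : 0 < d).
  { apply Rmin_pos; [lra|]. assert (0 < e * m) by nra. nra. }
  generalize (Hf d Hd). apply filter_imp. intros y H.
  assert (D1 : d <= m / 2) by apply Rmin_l.
  assert (D2 : d <= e * m * m / 4) by apply Rmin_r.
  assert (K : m / 2 <= Cmod (f y)).
  { generalize (Cmod_sub_ge (f x) (f y)). rewrite Cmod_sub_sym. fold m. lra. }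
  assert (Hy : f y <> RtoC 0) by (apply Cmod_ne0; lra).
  replace (/ f y - / f x)%C with ((f x - f y) / (f y * f x))%C by (field; auto).
  rewrite Cmod_div, Cmod_mult by (apply Cmult_neq_0; auto).
  rewrite Cmod_sub_sym. fold m.
  apply (Rmult_lt_reg_r (Cmod (f y) * m)); [nra|].
  unfold Rdiv. rewrite Rmult_assoc, Rinv_l by nra.
  assert (0 < e * m) by nra. nra.
Qed.

Lemma ccont_opp f x : ccont f x -> ccont (fun y => - f y)%C x.
Proof.
  intros H. apply ccont_ext with (fun y => (RtoC (-1)) * f y)%C.
  - intros y. ring.
  - apply ccont_mult; auto. apply ccont_const.
Qed.

Lemma ccont_minus f g x : ccont f x -> ccont g x -> ccont (fun y => f y - g y)%C x.
Proof. intros Hf Hg. apply ccont_plus; auto. now apply ccont_opp. Qed.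

Lemma ccont_div f g x : g x <> RtoC 0 -> ccont f x -> ccont g x -> ccont (fun y => f y / g y)%C x.
Proof. intros Hx Hf Hg. apply ccont_mult; auto. now apply ccont_inv. Qed.

Lemma ccont_comp (h : C -> C) f x :
  ccont f x -> @ccont Cspace h (f x) -> ccont (fun y => h (f y)) x.
Proof.
  intros Hf Hh e He.
  destruct (proj1 (locally_Cmod _ _) (Hh e He)) as (d & Hd & H).
  generalize (Hf d Hd). apply filter_imp. intros y. apply H.
Qed.

Lemma ccont_Re f x : ccont f x -> continuous (fun y => Re (f y)) x.
Proof.
  intros Hf. apply filterlim_locally. intros e.
  generalize (Hf e (cond_pos e)). apply filter_imp. intros y H.
  change (Rabs (Re (f y) - Re (f x)) < e).
  replace (Re (f y) - Re (f x)) with (Re (f y - f x)%C) by (unfold Re, Im; simpl; ring).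
  eapply Rle_lt_trans; [apply re_le_Cmod|exact H].
Qed.

Lemma im_le_Cmod (c : C) : Rabs (Im c) <= Cmod c.
Proof. eapply Rle_trans; [apply Rmax_r|apply Rmax_Cmod]. Qed.

Lemma ccont_Im f x : ccont f x -> continuous (fun y => Im (f y)) x.
Proof.
  intros Hf. apply filterlim_locally. intros e.
  generalize (Hf e (cond_pos e)). apply filter_imp. intros y H.
  change (Rabs (Im (f y) - Im (f x)) < e).
  replace (Im (f y) - Im (f x)) with (Im (f y - f x)%C) by (unfold Re, Im; simpl; ring).
  eapply Rle_lt_trans; [apply im_le_Cmod|exact H].
Qed.

Lemma Cmod_le_ReIm (c : C) : Cmod c <= Rabs (Re c) + Rabs (Im c).
Proof.
  replace c with (RtoC (Re c) + Ci * RtoC (Im c))%C at 1.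
  - eapply Rle_trans; [apply Cmod_triangle|]. rewrite Cmod_mult, Cmod_Ci, !Cmod_R. lra.
  - destruct c. unfold Ci, RtoC, Cplus, Cmult; simpl. f_equal; ring.
Qed.

Lemma ccont_pair (p q : U -> R) x :
  continuous p x -> continuous q x -> ccont (fun y => (p y, q y) : C) x.
Proof.
  intros Hp Hq e He.
  assert (E : 0 < e / 2) by lra.
  generalize (@filter_and _ (locally x) _ _ _ (proj1 (filterlim_locally _ _) Hp (mkposreal _ E))
                             (proj1 (filterlim_locally _ _) Hq (mkposreal _ E))).
  apply filter_imp. intros y [H1 H2].
  change (Rabs (p y - p x) < e / 2) in H1. change (Rabs (q y - q x) < e / 2) in H2.
  eapply Rle_lt_trans; [apply Cmod_le_ReIm|]. simpl.
  unfold Rminus in *. lra.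
Qed.

Lemma ccont_Cmod f x : ccont f x -> continuous (fun y => Cmod (f y)) x.
Proof.
  intros Hf. apply filterlim_locally. intros e.
  generalize (Hf e (cond_pos e)). apply filter_imp. intros y H.
  change (Rabs (Cmod (f y) - Cmod (f x)) < e).
  assert (A := Cmod_sub_ge (f y) (f x)). assert (B := Cmod_sub_ge (f x) (f y)).
  rewrite (Cmod_sub_sym (f x)) in B. apply Rabs_def1; lra.
Qed.
End Continuity.

Lemma ccont_id (z : C) : @ccont Cspace (fun w => w) z.
Proof. intros e He. apply locally_Cmod. exists e. auto. Qed.

(** * Rules for the complex derivative *)

Definition cdiff (f : C -> C) (z l : C) :=
  forall eps, 0 < eps -> exists d, 0 < d /\ forall w, Cmod (w - z) < d ->
    Cmod (f w - f z - l * (w - z)) <= eps * Cmod (w - z).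

Lemma is_derive_cdiff (f : C -> C) (z l : C) :
  @is_derive C_AbsRing C_NormedModule f z l <-> cdiff f z l.
Proof.
  split.
  - intros [_ H] e He.
    specialize (H z (fun P HP => HP) (mkposreal e He)).
    apply locally_Cmod in H. destruct H as (d & Hd & H).
    exists d. split; auto. intros w Hw. specialize (H w Hw).
    unfold norm in H; simpl in H. unfold minus, plus, opp, scal in H; simpl in H.
    unfold mult in H; simpl in H. unfold abs in H; simpl in H.
    rewrite Cmult_comm. exact H.
  - intros H. split.
    + apply is_linear_scal_l.
    + intros x Hx.
      (* The filter derivative asks for the expansion at every limit point of the neighbourhood
         filter; separation leaves only [z]. *)
      assert (E : x = z) by (symmetry; now apply is_filter_lim_locally_unique).
      subst x. intros e.
      destruct (H e (cond_pos e)) as (d & Hd & K).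
      apply locally_Cmod. exists d. split; auto. intros w Hw.
      specialize (K w Hw). rewrite Cmult_comm in K. exact K.
Qed.

Lemma ex_derive_cdiff (f : C -> C) (z : C) :
  @ex_derive C_AbsRing C_NormedModule f z <-> exists l, cdiff f z l.
Proof. split; intros [l H]; exists l; now apply is_derive_cdiff. Qed.

Lemma cdiff_C_derive (f : C -> C) (z : C) :
  (exists l, cdiff f z l) -> cdiff f z (C_derive f z).
Proof.
  intros H. apply is_derive_cdiff, C_derive_correct; [exact z|]. now apply ex_derive_cdiff.
Qed.

(* Caratheodory's form of differentiability: the rules of calculus become rules of continuity. *)
Lemma cdiff_slope (f : C -> C) (z l : C) :
  cdiff f z l <->
  exists phi, (forall w, f w = f z + phi w * (w - z))%C /\ phi z = l /\ @ccont Cspace phi z.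
Proof.
  split.
  - intros H.
    exists (fun w => if Ceq_dec w z then l else ((f w - f z) / (w - z))%C).
    split; [|split].
    + intros w. destruct (Ceq_dec w z) as [->|N]; [ring|].
      field. now apply Cminus_eq_contra.
    + now destruct (Ceq_dec z z).
    + intros e He. apply locally_Cmod.
      destruct (H (e/2) ltac:(lra)) as (d & Hd & K). exists d. split; auto.
      intros w Hw. destruct (Ceq_dec z z) as [_|]; [|easy].
      destruct (Ceq_dec w z) as [->|N].
      * replace (l - l)%C with (RtoC 0) by ring. now rewrite Cmod_0.
      * assert (N' := Cminus_eq_contra _ _ N). specialize (K w Hw).
        replace ((f w - f z) / (w - z) - l)%C with ((f w - f z - l * (w - z)) / (w - z))%C by (field; auto).
        rewrite Cmod_div by auto. apply Cmod_gt_0 in N'.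
        apply (Rmult_lt_reg_r (Cmod (w - z))); auto.
        unfold Rdiv. rewrite Rmult_assoc, Rinv_l by lra. nra.
  - intros (phi & E & <- & Hc) e He.
    destruct (proj1 (locally_Cmod _ _) (Hc e He)) as (d & Hd & K).
    exists d. split; auto. intros w Hw. rewrite E.
    replace (f z + phi w * (w - z) - f z - phi z * (w - z))%C with ((phi w - phi z) * (w - z))%C by ring.
    rewrite Cmod_mult. apply Rmult_le_compat_r; [apply Cmod_ge_0|]. left. now apply K.
Qed.

Lemma cdiff_ccont f z l : cdiff f z l -> @ccont Cspace f z.
Proof.
  intros H. apply cdiff_slope in H. destruct H as (phi & E & _ & Hc).
  apply (@ccont_ext Cspace) with (fun w => f z + phi w * (w - z))%C; [now intros|].
  apply (@ccont_plus Cspace); [apply ccont_const|].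
  apply (@ccont_mult Cspace); auto.
  apply (@ccont_minus Cspace); [apply ccont_id|apply ccont_const].
Qed.

Lemma cdiff_ext_loc f g z l :
  (exists d, 0 < d /\ forall w, Cmod (w - z) < d -> f w = g w) -> cdiff f z l -> cdiff g z l.
Proof.
  intros (d & Hd & E) H e He. destruct (H e He) as (d' & Hd' & K).
  exists (Rmin d d'). split; [now apply Rmin_pos|]. intros w Hw.
  rewrite <- !E.
  - apply K. eapply Rlt_le_trans; [exact Hw|apply Rmin_r].
  - replace (z - z)%C with (RtoC 0) by ring. now rewrite Cmod_0.
  - eapply Rlt_le_trans; [exact Hw|apply Rmin_l].
Qed.

Lemma cdiff_const c z : cdiff (fun _ => c) z (RtoC 0).
Proof.
  intros e He. exists 1. split; [lra|]. intros w _.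
  replace (c - c - 0 * (w - z))%C with (RtoC 0) by ring. rewrite Cmod_0.
  generalize (Cmod_ge_0 (w - z)). nra.
Qed.

Lemma cdiff_id z : cdiff (fun w => w) z (RtoC 1).
Proof.
  intros e He. exists 1. split; [lra|]. intros w _.
  replace (w - z - 1 * (w - z))%C with (RtoC 0) by ring. rewrite Cmod_0.
  generalize (Cmod_ge_0 (w - z)). nra.
Qed.

Lemma cdiff_plus f g z l m : cdiff f z l -> cdiff g z m -> cdiff (fun w => f w + g w)%C z (l + m)%C.
Proof.
  rewrite !cdiff_slope. intros (p & E & <- & Hp) (q & F & <- & Hq).
  exists (fun w => p w + q w)%C. split; [|split]; auto.
  - intros w. rewrite E, F. ring.
  - now apply (@ccont_plus Cspace).
Qed.

Lemma cdiff_mult f g z l m :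
  cdiff f z l -> cdiff g z m -> cdiff (fun w => f w * g w)%C z (l * g z + f z * m)%C.
Proof.
  intros Hf Hg. assert (Cg := cdiff_ccont _ _ _ Hg). revert Hf Hg.
  rewrite !cdiff_slope. intros (p & E & <- & Hp) (q & F & <- & Hq).
  exists (fun w => p w * g w + f z * q w)%C. split; [|split]; auto.
  - intros w. rewrite E, (F w). ring.
  - apply (@ccont_plus Cspace); apply (@ccont_mult Cspace); auto. apply ccont_const.
Qed.

Lemma cdiff_comp f g z l m :
  cdiff f (g z) l -> cdiff g z m -> cdiff (fun w => f (g w)) z (l * m)%C.
Proof.
  intros Hf Hg. assert (Cg := cdiff_ccont _ _ _ Hg). revert Hf Hg.
  rewrite !cdiff_slope. intros (p & E & <- & Hp) (q & F & <- & Hq).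
  exists (fun w => p (g w) * q w)%C. split; [|split]; auto.
  - intros w. rewrite E, (F w). ring.
  - apply (@ccont_mult Cspace); auto. now apply (@ccont_comp Cspace).
Qed.

Definition hol (f : C -> C) (z : C) := exists l, cdiff f z l.

Lemma hol_const c z : hol (fun _ => c) z.
Proof. eexists. apply cdiff_const. Qed.

Lemma hol_id z : hol (fun w => w) z.
Proof. eexists. apply cdiff_id. Qed.

Lemma hol_plus f g z : hol f z -> hol g z -> hol (fun w => f w + g w)%C z.
Proof. intros [l H] [m K]. eexists. apply cdiff_plus; eauto. Qed.

Lemma hol_mult f g z : hol f z -> hol g z -> hol (fun w => f w * g w)%C z.
Proof. intros [l H] [m K]. eexists. apply cdiff_mult; eauto. Qed.

Lemma hol_ext_loc f g z :
  (exists d, 0 < d /\ forall w, Cmod (w - z) < d -> f w = g w) -> hol f z -> hol g z.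
Proof. intros H [l K]. exists l. eapply cdiff_ext_loc; eauto. Qed.

Lemma hol_ext f g z : (forall w, f w = g w) -> hol f z -> hol g z.
Proof. intros H. apply hol_ext_loc. exists 1. split; [lra|auto]. Qed.

Lemma hol_comp f g z : hol f (g z) -> hol g z -> hol (fun w => f (g w)) z.
Proof. intros [l H] [m K]. eexists. eapply (cdiff_comp f g); eauto. Qed.

Lemma hol_ccont f z : hol f z -> @ccont Cspace f z.
Proof. intros [l H]. eapply cdiff_ccont; eauto. Qed.

Lemma hol_Cinv z : z <> RtoC 0 -> hol Cinv z.
Proof.
  intros Hz. exists (- / (z * z))%C. apply (cdiff_ext_loc (fun w => if Ceq_dec w 0 then Cinv 0 else / w)%C).
  { exists 1. split; [lra|]. intros w _. now destruct (Ceq_dec w 0) as [->|]. }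
  apply cdiff_slope.
  (* The slope identity is demanded for all [w], so at [w = 0] the slope is the difference quotient
     formed with the default value [Cinv 0]; close to [z <> 0] this branch is never reached. *)
  exists (fun w => if Ceq_dec w 0 then (Cinv 0 - Cinv z) / (0 - z) else - / (z * w))%C.
  assert (Hz' : (0 - z)%C <> RtoC 0) by (apply Cminus_eq_contra; auto).
  split; [|split].
  - intros w. destruct (Ceq_dec z 0) as [|_]; [easy|].
    destruct (Ceq_dec w 0) as [->|Hw].
    + unfold Cdiv at 1. rewrite <- Cmult_assoc, Cinv_l by auto. ring.
    + field. auto.
  - now destruct (Ceq_dec z 0).
  - apply (@ccont_ext_loc Cspace) with (fun w => - / (z * w))%C.
    + apply locally_Cmod. exists (Cmod z). split; [now apply Cmod_gt_0|].
      intros w Hw. destruct (Ceq_dec w 0) as [->|]; [|easy].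
      rewrite Cmod_sub_sym in Hw. replace (z - 0)%C with z in Hw by ring. lra.
    + apply (@ccont_opp Cspace), (@ccont_inv Cspace); [now apply Cmult_neq_0|].
      apply (@ccont_mult Cspace); [apply ccont_const|apply ccont_id].
Qed.

Lemma hol_inv f z : f z <> RtoC 0 -> hol f z -> hol (fun w => / f w)%C z.
Proof. intros H K. apply (hol_comp Cinv f); auto. now apply hol_Cinv. Qed.

Lemma hol_opp f z : hol f z -> hol (fun w => - f w)%C z.
Proof.
  intros H. apply hol_ext with (fun w => RtoC (-1) * f w)%C.
  - intros w. ring.
  - apply hol_mult; auto. apply hol_const.
Qed.

Lemma hol_minus f g z : hol f z -> hol g z -> hol (fun w => f w - g w)%C z.
Proof. intros H K. apply hol_plus; auto. now apply hol_opp. Qed.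

Lemma hol_div f g z : g z <> RtoC 0 -> hol f z -> hol g z -> hol (fun w => f w / g w)%C z.
Proof. intros. apply hol_mult; auto. now apply hol_inv. Qed.

Lemma hol_pow f z n : hol f z -> hol (fun w => f w ^ n)%C z.
Proof.
  intros H. induction n as [|n IH]; simpl.
  - apply hol_const.
  - apply hol_mult; auto.
Qed.

(** * Goursat's theorem on rectangles *)

Definition CInt (g : R -> C) (a b : R) : C :=
  (RInt (fun t => Re (g t)) a b, RInt (fun t => Im (g t)) a b).

Definition ccont_on (g : R -> C) (a b : R) := forall t, a <= t <= b -> ccont g t.

Lemma C_ext (x y : C) : Re x = Re y -> Im x = Im y -> x = y.
Proof. destruct x, y. unfold Re, Im; simpl. now intros -> ->. Qed.

Lemma Re_plus x y : Re (x + y)%C = Re x + Re y. Proof. reflexivity. Qed.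
Lemma Im_plus x y : Im (x + y)%C = Im x + Im y. Proof. reflexivity. Qed.
Lemma Re_mult x y : Re (x * y)%C = Re x * Re y - Im x * Im y. Proof. reflexivity. Qed.
Lemma Im_mult x y : Im (x * y)%C = Re x * Im y + Im x * Re y. Proof. reflexivity. Qed.

Section CIntegral.
Variables (a b : R).
Hypothesis Hab : a <= b.

Lemma ex_RInt_Re g : ccont_on g a b -> ex_RInt (fun t => Re (g t)) a b.
Proof.
  intros H. apply (ex_RInt_continuous (V := R_CompleteNormedModule)). intros t.
  rewrite Rmin_left, Rmax_right by auto. intros Ht. now apply (@ccont_Re R_UniformSpace), H.
Qed.

Lemma ex_RInt_Im g : ccont_on g a b -> ex_RInt (fun t => Im (g t)) a b.
Proof.
  intros H. apply (ex_RInt_continuous (V := R_CompleteNormedModule)). intros t.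
  rewrite Rmin_left, Rmax_right by auto. intros Ht. now apply (@ccont_Im R_UniformSpace), H.
Qed.

Lemma CInt_ext g h : (forall t, a <= t <= b -> g t = h t) -> CInt g a b = CInt h a b.
Proof.
  intros H. apply injective_projections; simpl; apply RInt_ext; intros t;
  rewrite Rmin_left, Rmax_right by auto; intros Ht; rewrite H; auto; lra.
Qed.

Lemma CInt_plus g h : ccont_on g a b -> ccont_on h a b ->
  CInt (fun t => g t + h t)%C a b = (CInt g a b + CInt h a b)%C.
Proof.
  intros Hg Hh. apply injective_projections; simpl.
  - rewrite <- (RInt_plus (V := R_CompleteNormedModule)) by (now apply ex_RInt_Re). reflexivity.
  - rewrite <- (RInt_plus (V := R_CompleteNormedModule)) by (now apply ex_RInt_Im). reflexivity.
Qed.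

Lemma CInt_scal c g : ccont_on g a b ->
  CInt (fun t => c * g t)%C a b = (c * CInt g a b)%C.
Proof.
  intros Hg. assert (R1 := ex_RInt_Re _ Hg). assert (R2 := ex_RInt_Im _ Hg).
  assert (Sc : forall (k : R) h, ex_RInt h a b -> ex_RInt (fun t => k * h t) a b).
  { intros k h. exact (ex_RInt_scal (V := R_CompleteNormedModule) h a b k). }
  assert (Si : forall (k : R) h, ex_RInt h a b -> RInt (fun t => k * h t) a b = k * RInt h a b).
  { intros k h. exact (RInt_scal (V := R_CompleteNormedModule) h a b k). }
  apply injective_projections; simpl.
  - rewrite <- !Si by auto.
    exact (RInt_minus (V := R_CompleteNormedModule) _ _ a b (Sc (fst c) _ R1) (Sc (snd c) _ R2)).
  - rewrite <- !Si by auto.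
    exact (RInt_plus (V := R_CompleteNormedModule) _ _ a b (Sc (fst c) _ R2) (Sc (snd c) _ R1)).
Qed.

Lemma CInt_minus g h : ccont_on g a b -> ccont_on h a b ->
  CInt (fun t => g t - h t)%C a b = (CInt g a b - CInt h a b)%C.
Proof.
  intros Hg Hh.
  rewrite (CInt_ext _ (fun t => g t + RtoC (-1) * h t)%C) by (intros; ring).
  rewrite CInt_plus, CInt_scal; auto; [ring|].
  intros t Ht. apply (@ccont_mult R_UniformSpace); [apply ccont_const|auto].
Qed.

Lemma CInt_const c : CInt (fun _ => c) a b = (c * RtoC (b - a))%C.
Proof.
  apply C_ext; unfold CInt.
  - rewrite Re_mult. unfold Re, Im; simpl. rewrite (RInt_const (V := R_CompleteNormedModule)).
    unfold scal; simpl. unfold mult; simpl. ring.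
  - rewrite Im_mult. unfold Re, Im; simpl. rewrite (RInt_const (V := R_CompleteNormedModule)).
    unfold scal; simpl. unfold mult; simpl. ring.
Qed.

(* Rotating the integral onto the positive axis reduces the bound to the real one. *)
Lemma CInt_bound g M : ccont_on g a b -> (forall t, a <= t <= b -> Cmod (g t) <= M) ->
  Cmod (CInt g a b) <= M * (b - a).
Proof.
  intros Hg HM. set (I := CInt g a b).
  assert (M0 : 0 <= M).
  { eapply Rle_trans; [apply Cmod_ge_0|]. apply (HM a). lra. }
  assert (E : Re (Cconj I * CInt g a b)%C = Cmod I ^ 2).
  { rewrite Cmod2_alt, Re_mult. fold I. unfold Cconj, Re, Im; simpl. ring. }
  rewrite <- CInt_scal in E by auto.
  assert (CI : ccont_on (fun t => Cconj I * g t)%C a b).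
  { intros t Ht. apply (@ccont_mult R_UniformSpace); [apply ccont_const|auto]. }
  assert (L : Re (CInt (fun t => Cconj I * g t)%C a b) <= RInt (fun _ => Cmod I * M) a b).
  { apply RInt_le; auto.
    - now apply ex_RInt_Re.
    - apply ex_RInt_const.
    - intros t Ht. eapply Rle_trans; [apply Rle_abs|]. eapply Rle_trans; [apply re_le_Cmod|].
      rewrite Cmod_mult, Cmod_conj. apply Rmult_le_compat_l; [apply Cmod_ge_0|]. apply HM. lra. }
  rewrite E, (RInt_const (V := R_CompleteNormedModule)) in L. unfold scal in L; simpl in L. unfold mult in L; simpl in L.
  destruct (Req_dec (Cmod I) 0) as [->|N]; [nra|].
  assert (P := Cmod_ge_0 I). apply (Rmult_le_reg_l (Cmod I)); lra.
Qed.
End CIntegral.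

Lemma CInt_Chasles g a b c : a <= b <= c -> ccont_on g a c ->
  CInt g a c = (CInt g a b + CInt g b c)%C.
Proof.
  intros [H1 H2] Hg.
  assert (A : ccont_on g a b) by (intros t Ht; apply Hg; lra).
  assert (B : ccont_on g b c) by (intros t Ht; apply Hg; lra).
  apply injective_projections; simpl; symmetry; apply (RInt_Chasles (V := R_CompleteNormedModule));
  auto using ex_RInt_Re, ex_RInt_Im.
Qed.

(** The counterclockwise contour integral of F over the boundary of $[a,b]\times[c,d]$, with
    opposite sides paired: bottom minus top, then right minus left times i. *)
Definition rect_int (F : C -> C) (a b c d : R) : C :=
  (CInt (fun x => F (x, c) - F (x, d)) a b + Ci * CInt (fun y => F (b, y) - F (a, y)) c d)%C.

Definition hol_rect (F : C -> C) (a b c d : R) :=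
  forall x y, a <= x <= b -> c <= y <= d -> hol F (x, y).

Lemma ccont_hline (y x : R) : @ccont R_UniformSpace (fun x => (x, y) : C) x.
Proof. apply (@ccont_pair R_UniformSpace); [apply continuous_id|apply continuous_const]. Qed.

Lemma ccont_vline (x y : R) : @ccont R_UniformSpace (fun y => (x, y) : C) y.
Proof. apply (@ccont_pair R_UniformSpace); [apply continuous_const|apply continuous_id]. Qed.

Section Rect.
Variables (F : C -> C) (a b c d : R).
Hypothesis HF : hol_rect F a b c d.

Lemma ccont_on_h y : c <= y <= d -> ccont_on (fun x => F (x, y)) a b.
Proof.
  intros Hy x Hx. apply (@ccont_comp R_UniformSpace F (fun x => (x, y))).
  - apply ccont_hline.
  - now apply hol_ccont, HF.
Qed.

Lemma ccont_on_v x : a <= x <= b -> ccont_on (fun y => F (x, y)) c d.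
Proof.
  intros Hx y Hy. apply (@ccont_comp R_UniformSpace F (fun y => (x, y))).
  - apply ccont_vline.
  - now apply hol_ccont, HF.
Qed.

Lemma ccont_on_minus g h u v : ccont_on g u v -> ccont_on h u v -> ccont_on (fun t => g t - h t)%C u v.
Proof. intros Hg Hh t Ht. apply (@ccont_minus R_UniformSpace); auto. Qed.

Lemma rect_int_split_x m : a <= m <= b -> c <= d ->
  rect_int F a b c d = (rect_int F a m c d + rect_int F m b c d)%C.
Proof.
  intros Hm Hcd. unfold rect_int.
  rewrite (CInt_Chasles _ a m b) by (auto; apply ccont_on_minus; apply ccont_on_h; lra).
  rewrite !(CInt_minus c d) by (try apply ccont_on_v; lra). ring.
Qed.

Lemma rect_int_split_y m : c <= m <= d -> a <= b ->
  rect_int F a b c d = (rect_int F a b c m + rect_int F a b m d)%C.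
Proof.
  intros Hm Hab. unfold rect_int.
  rewrite (CInt_Chasles _ c m d) by (auto; apply ccont_on_minus; apply ccont_on_v; lra).
  rewrite !(CInt_minus a b) by (try apply ccont_on_h; lra). ring.
Qed.

Lemma Cmod_le_rect (x y x' y' : R) : a <= x <= b -> a <= x' <= b -> c <= y <= d -> c <= y' <= d ->
  Cmod ((x, y) - (x', y'))%C <= (b - a) + (d - c).
Proof.
  intros. eapply Rle_trans; [apply Cmod_le_ReIm|].
  apply Rplus_le_compat; apply Rabs_le; unfold Re, Im; simpl; lra.
Qed.

(** The affine part of [F] integrates to 0 around the rectangle. What remains on a pair of opposite
    sides is at most 2 [eps] times the half-perimeter, and the lengths of the two pairs add up to
    one more half-perimeter. *)
Lemma rect_int_local p q l eps : a <= p <= b -> c <= q <= d -> 0 <= eps ->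
  (forall x y, a <= x <= b -> c <= y <= d ->
     Cmod (F (x, y) - F (p, q) - l * ((x, y) - (p, q)))%C <= eps * Cmod ((x, y) - (p, q))%C) ->
  Cmod (rect_int F a b c d) <= 2 * eps * ((b - a) + (d - c)) ^ 2.
Proof.
  intros Hp Hq He H. set (P := (b - a) + (d - c)).
  assert (K : forall x y, a <= x <= b -> c <= y <= d ->
     Cmod (F (x, y) - F (p, q) - l * ((x, y) - (p, q)))%C <= eps * P).
  { intros x y Hx Hy. eapply Rle_trans; [now apply H|].
    apply Rmult_le_compat_l; auto. now apply Cmod_le_rect. }
  (* Differences of the linear map $w\mapsto lw$ across the two pairs of sides; their contributions
     $k_1(b-a)$ and $i\,k_2(d-c)$ cancel. *)
  set (k1 := (- (Ci * l * RtoC (d - c)))%C). set (k2 := (l * RtoC (b - a))%C).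
  assert (E : rect_int F a b c d =
     (CInt (fun x => (F (x, c) - F (x, d)) - k1) a b + Ci * CInt (fun y => (F (b, y) - F (a, y)) - k2) c d)%C).
  { unfold rect_int.
    rewrite (CInt_minus a b ltac:(lra) (fun x => F (x, c) - F (x, d))%C (fun _ => k1)).
    - rewrite (CInt_minus c d ltac:(lra) (fun y => F (b, y) - F (a, y))%C (fun _ => k2)).
      + rewrite !CInt_const by lra. unfold k1, k2. ring.
      + apply ccont_on_minus; apply ccont_on_v; lra.
      + intros t _. apply ccont_const.
    - apply ccont_on_minus; apply ccont_on_h; lra.
    - intros t _. apply ccont_const. }
  rewrite E. eapply Rle_trans; [apply Cmod_triangle|]. rewrite Cmod_mult, Cmod_Ci, Rmult_1_l.
  replace (2 * eps * P ^ 2) with (2 * eps * P * (b - a) + 2 * eps * P * (d - c)) by (unfold P; ring).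
  apply Rplus_le_compat; apply CInt_bound; try lra.
  - apply ccont_on_minus; [apply ccont_on_minus; apply ccont_on_h; lra|intros t _; apply ccont_const].
  - intros x Hx.
    replace (F (x, c) - F (x, d) - k1)%C with
      ((F (x, c) - F (p, q) - l * ((x, c) - (p, q))) - (F (x, d) - F (p, q) - l * ((x, d) - (p, q))))%C.
    + eapply Rle_trans; [apply Cmod_sub_le|].
      assert (A := K x c Hx ltac:(lra)). assert (B := K x d Hx ltac:(lra)). lra.
    + unfold k1. transitivity (F (x, c) - F (x, d) + l * ((x, d) - (x, c)))%C; [ring|].
      replace ((x, d) - (x, c))%C with (Ci * RtoC (d - c))%C; [ring|].
      apply injective_projections; simpl; ring.
  - apply ccont_on_minus; [apply ccont_on_minus; apply ccont_on_v; lra|intros t _; apply ccont_const].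
  - intros y Hy.
    replace (F (b, y) - F (a, y) - k2)%C with
      ((F (b, y) - F (p, q) - l * ((b, y) - (p, q))) - (F (a, y) - F (p, q) - l * ((a, y) - (p, q))))%C.
    + eapply Rle_trans; [apply Cmod_sub_le|].
      assert (A := K b y ltac:(lra) Hy). assert (B := K a y ltac:(lra) Hy). lra.
    + unfold k2. transitivity (F (b, y) - F (a, y) + l * ((a, y) - (b, y)))%C; [ring|].
      replace ((a, y) - (b, y))%C with (- RtoC (b - a))%C; [ring|].
      apply injective_projections; simpl; ring.
Qed.
End Rect.

(** The point is the supremum of the left ends: by nesting, every left end lies below every right
    end. *)
Lemma nested_halving (u : nat -> R) (W : R) : 0 <= W ->
  (forall n, u n <= u (S n) <= u n + W / 2 ^ S n) ->
  exists p, forall n, u n <= p <= u n + W / 2 ^ n.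
Proof.
  intros HW H.
  assert (P2 : forall n, 0 < 2 ^ n) by (intros; apply pow_lt; lra).
  assert (S2 : forall n, W / 2 ^ n = W / 2 ^ S n + W / 2 ^ S n).
  { intros n. simpl. field. apply Rgt_not_eq, P2. }
  assert (Q : forall n, 0 <= W / 2 ^ n).
  { intros n. apply Rdiv_le_0_compat; auto. }
  assert (A : forall n k, u n <= u (n + k)%nat /\ u (n + k)%nat + W / 2 ^ (n + k) <= u n + W / 2 ^ n).
  { intros n k. induction k as [|k IH].
    - rewrite Nat.add_0_r. lra.
    - rewrite Nat.add_succ_r. specialize (H (n + k)%nat). specialize (S2 (n + k)%nat). lra. }
  assert (B : forall m n, u m <= u n + W / 2 ^ n).
  { intros m n. destruct (Nat.le_ge_cases m n) as [L|L].
    - destruct (A m (n - m)%nat) as [A1 _]. replace (m + (n - m))%nat with n in A1 by lia.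
      specialize (Q n). lra.
    - destruct (A n (m - n)%nat) as [_ A2]. replace (n + (m - n))%nat with m in A2 by lia.
      specialize (Q m). lra. }
  destruct (completeness (fun x => exists n, x = u n)) as [p [U L]].
  - exists (u 0%nat + W / 2 ^ 0). intros x [n ->]. apply B.
  - now exists (u 0%nat), 0%nat.
  - exists p. intros n. split.
    + apply U. now exists n.
    + apply L. intros x [m ->]. apply B.
Qed.

Theorem goursat_rect F a b c d : a <= b -> c <= d -> hol_rect F a b c d ->
  rect_int F a b c d = RtoC 0.
Proof.
  intros Hab Hcd HF. apply Cmod_eq_0, Rle_antisym; [|apply Cmod_ge_0].
  apply le_epsilon. intros e0 He0. rewrite Rplus_0_l.
  set (W := b - a). set (H := d - c). set (P := W + H).
  assert (HP : 0 <= P) by (unfold P, W, H; lra).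
  assert (Hex : exists e, 0 < e /\ e * P ^ 2 <= e0).
  (* The summand 1 covers a rectangle degenerated to a point, where [P = 0]. *)
  { exists (e0 / (P ^ 2 + 1)). split; [apply Rdiv_lt_0_compat; nra|].
    apply (Rmult_le_reg_r (P ^ 2 + 1)); [nra|].
    replace (e0 / (P ^ 2 + 1) * P ^ 2 * (P ^ 2 + 1)) with (e0 * P ^ 2) by (field; nra). nra. }
  destruct Hex as (e & He & Hee).
  eapply Rle_trans; [|exact Hee]. clear e0 He0 Hee.
  apply Rnot_lt_le. intros Hbad.
  assert (P2 : forall n, 0 < 2 ^ n) by (intros; apply pow_lt; lra).
  (* [p] is the lower left corner of a copy scaled by $2^{-n}$. The threshold is quadratic in the
     size, so it drops by 4 at each halving, and by the triangle inequality one of the four quarters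
     is bad again. *)
  set (Bad := fun n (p : R * R) =>
     a <= fst p /\ fst p + W / 2 ^ n <= b /\ c <= snd p /\ snd p + H / 2 ^ n <= d /\
     e * (P / 2 ^ n) ^ 2 < Cmod (rect_int F (fst p) (fst p + W / 2 ^ n) (snd p) (snd p + H / 2 ^ n))).
  assert (Step : forall n p, Bad n p -> exists p', Bad (S n) p' /\
     fst p <= fst p' <= fst p + W / 2 ^ S n /\ snd p <= snd p' <= snd p + H / 2 ^ S n).
  { intros n [x y] (B1 & B2 & B3 & B4 & B5). simpl fst in *. simpl snd in *.
    set (w := W / 2 ^ S n). set (h := H / 2 ^ S n).
    assert (Hn := P2 n).
    assert (w0 : 0 <= w) by (apply Rdiv_le_0_compat; [unfold W; lra|apply P2]).
    assert (h0 : 0 <= h) by (apply Rdiv_le_0_compat; [unfold H; lra|apply P2]).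
    assert (w2 : W / 2 ^ n = w + w) by (unfold w; simpl; field; lra).
    assert (h2 : H / 2 ^ n = h + h) by (unfold h; simpl; field; lra).
    assert (Pe : P / 2 ^ n = 2 * (P / 2 ^ S n)) by (simpl; field; lra).
    rewrite w2, h2 in *. rewrite Pe in B5.
    assert (Sub : forall x1 x2 y1 y2, x <= x1 -> x2 <= x + (w + w) -> y <= y1 -> y2 <= y + (h + h) ->
       hol_rect F x1 x2 y1 y2).
    { intros x1 x2 y1 y2 ? ? ? ? s t Hs Ht. apply HF; lra. }
    rewrite (rect_int_split_x F _ _ _ _ (Sub x (x + (w + w)) y (y + (h + h)) ltac:(lra) ltac:(lra) ltac:(lra) ltac:(lra)) (x + w)) in B5 by lra.
    rewrite (rect_int_split_y F _ _ _ _ (Sub x (x + w) y (y + (h + h)) ltac:(lra) ltac:(lra) ltac:(lra) ltac:(lra)) (y + h)) in B5 by lra.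
    rewrite (rect_int_split_y F _ _ _ _ (Sub (x + w) (x + (w + w)) y (y + (h + h)) ltac:(lra) ltac:(lra) ltac:(lra) ltac:(lra)) (y + h)) in B5 by lra.
    replace (x + (w + w)) with (x + w + w) in B5 by ring.
    replace (y + (h + h)) with (y + h + h) in B5 by ring.
    set (r1 := rect_int F x (x + w) y (y + h)) in *.
    set (r2 := rect_int F x (x + w) (y + h) (y + h + h)) in *.
    set (r3 := rect_int F (x + w) (x + w + w) y (y + h)) in *.
    set (r4 := rect_int F (x + w) (x + w + w) (y + h) (y + h + h)) in *.
    assert (T1 := Cmod_triangle (r1 + r2) (r3 + r4)).
    assert (T2 := Cmod_triangle r1 r2). assert (T3 := Cmod_triangle r3 r4).
    set (k := P / 2 ^ S n) in *.
    destruct (Rlt_le_dec (e * k ^ 2) (Cmod r1)) as [G|G1];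
      [exists (x, y)|destruct (Rlt_le_dec (e * k ^ 2) (Cmod r2)) as [G|G2];
        [exists (x, y + h)|destruct (Rlt_le_dec (e * k ^ 2) (Cmod r3)) as [G|G3];
          [exists (x + w, y)|destruct (Rlt_le_dec (e * k ^ 2) (Cmod r4)) as [G|G4];
            [exists (x + w, y + h)|exfalso; lra]]]];
      unfold Bad; simpl fst; simpl snd; fold w h k; repeat split; try lra; exact G. }
  (* Which quarter is bad cannot be computed, so [epsilon] picks one; its specification is available
     as long as the current rectangle is bad. *)
  set (next := fun n p => epsilon (inhabits p) (fun p' => Bad (S n) p' /\
     fst p <= fst p' <= fst p + W / 2 ^ S n /\ snd p <= snd p' <= snd p + H / 2 ^ S n)).
  set (s := nat_rect (fun _ => (R * R)%type) (a, c) next).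
  assert (Bs : forall n, Bad n (s n)).
  { intros n. induction n as [|n IH].
    - unfold Bad, s; simpl. replace (W / 1) with W by field. replace (H / 1) with H by field.
      replace (P / 1) with P by field. unfold W, H in *.
      replace (a + (b - a)) with b by ring. replace (c + (d - c)) with d by ring.
      repeat split; try lra.
    - assert (Q := epsilon_spec (inhabits (s n)) _ (Step n (s n) IH)). exact (proj1 Q). }
  assert (Ss : forall n, fst (s n) <= fst (s (S n)) <= fst (s n) + W / 2 ^ S n /\
                         snd (s n) <= snd (s (S n)) <= snd (s n) + H / 2 ^ S n).
  { intros n. exact (proj2 (epsilon_spec (inhabits (s n)) _ (Step n (s n) (Bs n)))). }
  destruct (nested_halving (fun n => fst (s n)) W) as [p Hp];
    [unfold W; lra|intros n; apply Ss|].
  destruct (nested_halving (fun n => snd (s n)) H) as [q Hq];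
    [unfold H; lra|intros n; apply Ss|].
  assert (p0 := Hp 0%nat). assert (q0 := Hq 0%nat). simpl in p0, q0.
  destruct (HF p q) as [l Hl]; [unfold W in *; lra|unfold H in *; lra|].
  (* Half of [e] absorbs the factor 2 in [rect_int_local]. *)
  destruct (Hl (e / 2) ltac:(lra)) as (dl & Hdl & K).
  assert (HN : exists N, P / 2 ^ N < dl).
  { destruct (pow_lt_1_zero (/ 2)) with (y := dl / (P + 1)) as [N HN].
    - rewrite Rabs_right; lra.
    - apply Rdiv_lt_0_compat; lra.
    - exists N. specialize (HN N (Nat.le_refl _)).
      rewrite pow_inv, Rabs_right in HN by (left; apply Rinv_0_lt_compat, P2).
      unfold Rdiv. apply Rle_lt_trans with ((P + 1) * / 2 ^ N).
      + apply Rmult_le_compat_r; [left; apply Rinv_0_lt_compat, P2|lra].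
      + apply (Rmult_lt_reg_l (/ (P + 1))); [apply Rinv_0_lt_compat; lra|].
        rewrite <- Rmult_assoc, Rinv_l by lra. unfold Rdiv in HN. lra. }
  destruct HN as [N HN].
  destruct (Bs N) as (B1 & B2 & B3 & B4 & B5).
  specialize (Hp N). specialize (Hq N). simpl in Hp, Hq.
  assert (L := rect_int_local F (fst (s N)) (fst (s N) + W / 2 ^ N) (snd (s N)) (snd (s N) + H / 2 ^ N)).
  assert (EP : fst (s N) + W / 2 ^ N - fst (s N) + (snd (s N) + H / 2 ^ N - snd (s N)) = P / 2 ^ N).
  { unfold P. field. apply Rgt_not_eq, P2. }
  specialize (L ltac:(intros x y Hx Hy; apply HF; lra) p q l (e / 2) Hp Hq ltac:(lra)).
  rewrite EP in L. replace (2 * (e / 2)) with e in L by field.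
  assert (Cmod (rect_int F (fst (s N)) (fst (s N) + W / 2 ^ N) (snd (s N)) (snd (s N) + H / 2 ^ N))
    <= e * (P / 2 ^ N) ^ 2); [|lra].
  apply L. intros x y Hx Hy. apply K.
  eapply Rle_lt_trans; [|exact HN]. rewrite <- EP.
  now apply Cmod_le_rect.
Qed.

(** * Cauchy's formula on circles *)

Definition cexp (w : C) : C := (exp (Re w) * cos (Im w), exp (Re w) * sin (Im w)).

Definition circ (s t : R) : C := (s * cos t, s * sin t).

Lemma cexp_plus z w : cexp (z + w) = (cexp z * cexp w)%C.
Proof.
  unfold cexp. rewrite Re_plus, Im_plus, exp_plus, cos_plus, sin_plus.
  apply injective_projections; simpl; ring.
Qed.

Lemma deriv_at_0 (f : R -> R) l : derivable_pt_lim f 0 l ->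
  forall eps, 0 < eps -> exists d, 0 < d /\ forall x, Rabs x < d ->
    Rabs (f x - f 0 - l * x) <= eps * Rabs x.
Proof.
  intros H e He. destruct (H e He) as [d K]. exists d. split; [apply cond_pos|].
  intros x Hx. destruct (Req_dec x 0) as [->|N].
  - replace (f 0 - f 0 - l * 0) with 0 by ring. rewrite Rabs_R0. lra.
  - specialize (K x N Hx). rewrite Rplus_0_l in K.
    replace (f x - f 0 - l * x) with (((f x - f 0) / x - l) * x) by (field; auto).
    rewrite Rabs_mult. apply Rmult_le_compat_r; [apply Rabs_pos|lra].
Qed.

Lemma cdiff_cexp_0 : cdiff cexp (RtoC 0) (RtoC 1).
Proof.
  (* The four error terms are at most 1, 3, 2 and 3 times [k * m], where [m] is the modulus of the
     increment; 9 is the sum of these factors. *)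
  intros e He. set (k := Rmin 1 (e / 9)).
  assert (Hk : 0 < k) by (apply Rmin_pos; lra).
  assert (k1 : k <= 1) by apply Rmin_l. assert (k2 : k <= e / 9) by apply Rmin_r.
  destruct (deriv_at_0 exp 1 derivable_pt_lim_exp_0 k Hk) as (d1 & P1 & K1).
  destruct (deriv_at_0 cos 0) with (eps := k) as (d2 & P2 & K2); auto.
  { generalize (derivable_pt_lim_cos 0). rewrite sin_0, Ropp_0. auto. }
  destruct (deriv_at_0 sin 1) with (eps := k) as (d3 & P3 & K3); auto.
  { generalize (derivable_pt_lim_sin 0). rewrite cos_0. auto. }
  set (d := Rmin k (Rmin d1 (Rmin d2 d3))).
  assert (Hd : 0 < d) by (unfold d; apply Rmin_pos; [|apply Rmin_pos; [|apply Rmin_pos]]; auto).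
  assert (Ld : d <= k /\ d <= d1 /\ d <= d2 /\ d <= d3).
  { unfold d. generalize (Rmin_l k (Rmin d1 (Rmin d2 d3))) (Rmin_r k (Rmin d1 (Rmin d2 d3)))
      (Rmin_l d1 (Rmin d2 d3)) (Rmin_r d1 (Rmin d2 d3)) (Rmin_l d2 d3) (Rmin_r d2 d3). lra. }
  exists d. split; auto. intros [a b]. replace ((a, b) - 0)%C with ((a, b) : C)
    by (apply injective_projections; simpl; ring).
  intros Hw.
  assert (Ha : Rabs a <= Cmod (a, b)) by apply (re_le_Cmod (a, b)).
  assert (Hb : Rabs b <= Cmod (a, b)) by apply (im_le_Cmod (a, b)).
  set (m := Cmod (a, b)) in *.
  specialize (K1 a ltac:(lra)). specialize (K2 b ltac:(lra)). specialize (K3 b ltac:(lra)).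
  rewrite exp_0 in K1. rewrite cos_0, Rmult_0_l, Rminus_0_r in K2.
  rewrite sin_0, Rminus_0_r in K3.
  assert (Qa := Rabs_pos a). assert (Qb := Rabs_pos b).
  assert (X1 : Rabs (exp a - 1) <= 2 * Rabs a).
  { replace (exp a - 1) with ((exp a - 1 - 1 * a) + a) by ring.
    eapply Rle_trans; [apply Rabs_triang|]. nra. }
  assert (X2 : Rabs (exp a) <= 3).
  { replace (exp a) with ((exp a - 1) + 1) by ring.
    eapply Rle_trans; [apply Rabs_triang|]. rewrite Rabs_R1. lra. }
  eapply Rle_trans; [apply Cmod_le_ReIm|].
  replace (Re (cexp (a, b) - cexp 0 - 1 * (a, b))%C) with
    ((exp a - 1 - 1 * a) + exp a * (cos b - 1)).
  2:{ unfold cexp, Re, Im; simpl. rewrite ?exp_0, ?cos_0, ?sin_0. ring. }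
  replace (Im (cexp (a, b) - cexp 0 - 1 * (a, b))%C) with
    (exp a * (sin b - 1 * b) + (exp a - 1) * b).
  2:{ unfold cexp, Re, Im; simpl. rewrite ?exp_0, ?cos_0, ?sin_0. ring. }
  assert (Y1 := Rabs_triang (exp a - 1 - 1 * a) (exp a * (cos b - 1))).
  assert (Y2 := Rabs_triang (exp a * (sin b - 1 * b)) ((exp a - 1) * b)).
  rewrite Rabs_mult in Y1. rewrite !Rabs_mult in Y2.
  assert (Z1 : Rabs (exp a) * Rabs (cos b - 1) <= 3 * (k * m)).
  { apply Rmult_le_compat; try apply Rabs_pos; auto. eapply Rle_trans; [exact K2|]. nra. }
  assert (Z2 : Rabs (exp a) * Rabs (sin b - 1 * b) <= 3 * (k * m)).
  { apply Rmult_le_compat; try apply Rabs_pos; auto. eapply Rle_trans; [exact K3|]. nra. }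
  assert (Z3 : Rabs (exp a - 1) * Rabs b <= 2 * k * m).
  { apply Rmult_le_compat; try apply Rabs_pos; auto. lra. }
  assert (Z4 : k * Rabs a <= k * m) by nra.
  assert (Z5 : 9 * (k * m) <= e * m) by nra. lra.
Qed.

(** The functional equation carries the derivative at 0 to every point. *)
Lemma hol_cexp z : hol cexp z.
Proof.
  apply hol_ext with (fun w => cexp z * cexp (w - z))%C.
  { intros w. rewrite <- cexp_plus. f_equal. ring. }
  apply hol_mult; [apply hol_const|].
  apply (hol_comp cexp (fun w => w - z)%C).
  - replace (z - z)%C with (RtoC 0) by ring. eexists; apply cdiff_cexp_0.
  - apply hol_minus; [apply hol_id|apply hol_const].
Qed.

Lemma Cmod_circ s t : 0 <= s -> Cmod (circ s t) = s.
Proof.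
  intros Hs. unfold Cmod, circ; simpl.
  replace (s * cos t * (s * cos t * 1) + s * sin t * (s * sin t * 1)) with (s * s * ((sin t)² + (cos t)²))
    by (unfold Rsqr; ring).
  rewrite sin2_cos2, Rmult_1_r. now apply sqrt_square.
Qed.

Lemma cexp_circ x t : cexp (x, t) = circ (exp x) t.
Proof. reflexivity. Qed.

Lemma ccont_circ s t : @ccont R_UniformSpace (circ s) t.
Proof.
  apply (@ccont_pair R_UniformSpace);
  apply (continuous_mult (U := R_UniformSpace) (K := R_AbsRing)); try apply continuous_const.
  - apply continuity_pt_filterlim, continuity_cos.
  - apply continuity_pt_filterlim, continuity_sin.
Qed.

Lemma ccont_comp_circ h s : 0 <= s -> (forall w, Cmod w = s -> @ccont Cspace h w) ->
  ccont_on (fun t => h (circ s t)) 0 (2 * PI).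
Proof.
  intros Hs H t _. apply (@ccont_comp R_UniformSpace h (circ s)); [apply ccont_circ|].
  apply H. now apply Cmod_circ.
Qed.

Lemma PI2_pos : 0 < 2 * PI.
Proof. generalize PI_RGT_0; lra. Qed.

(** This is $2\pi$ times the mean of [h], not a contour integral. Since $dw=iw\,dt$, the contour
    integral of F is i times the circle integral of $wF(w)$; hence the extra factor [w] in the
    Cauchy kernels below. *)
Definition circle_int (h : C -> C) (s : R) : C := CInt (fun t => h (circ s t)) 0 (2 * PI).

Lemma circle_int_ext h k s : 0 <= s -> (forall w, Cmod w = s -> h w = k w) -> circle_int h s = circle_int k s.
Proof.
  intros Hs H. assert (P := PI2_pos). apply CInt_ext; [lra|]. intros t _. apply H. now apply Cmod_circ.
Qed.

(* Goursat's theorem for [h o exp] on a rectangle of height 2 pi: the horizontal sides cancel. *)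
Lemma circle_int_const h s1 s2 : 0 < s1 -> s1 <= s2 ->
  (forall w, s1 <= Cmod w <= s2 -> hol h w) -> circle_int h s1 = circle_int h s2.
Proof.
  intros H1 H2 H. assert (P := PI2_pos).
  assert (L : ln s1 <= ln s2).
  { destruct (Rle_lt_or_eq_dec _ _ H2) as [L| ->]; [left; apply ln_increasing|]; lra. }
  assert (G := goursat_rect (fun w => h (cexp w)) (ln s1) (ln s2) 0 (2 * PI) L ltac:(lra)).
  assert (HF : hol_rect (fun w => h (cexp w)) (ln s1) (ln s2) 0 (2 * PI)).
  { intros x y Hx _. apply hol_comp; [|apply hol_cexp]. apply H.
    rewrite cexp_circ, Cmod_circ by (left; apply exp_pos).
    rewrite <- (exp_ln s1), <- (exp_ln s2) by lra. split.
    - destruct (Rle_lt_or_eq_dec _ _ (proj1 Hx)) as [K| ->]; [left; now apply exp_increasing|lra].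
    - destruct (Rle_lt_or_eq_dec _ _ (proj2 Hx)) as [K| ->]; [left; now apply exp_increasing|lra]. }
  specialize (G HF). unfold rect_int in G.
  rewrite (CInt_ext (ln s1) (ln s2) L _ (fun _ => RtoC 0)) in G.
  2:{ intros x _. rewrite !cexp_circ. unfold circ. rewrite cos_2PI, sin_2PI, cos_0, sin_0. ring. }
  rewrite CInt_const, Cmult_0_l, Cplus_0_l, CInt_minus in G; try lra.
  - assert (D : (circle_int h s2 - circle_int h s1)%C = RtoC 0).
    { unfold circle_int. rewrite <- (exp_ln s1), <- (exp_ln s2) by lra.
      apply (f_equal (Cmult (- Ci))) in G. rewrite Cmult_0_r, Cmult_assoc in G.
      replace (- Ci * Ci)%C with (RtoC 1) in G by (apply injective_projections; simpl; ring).
      rewrite Cmult_1_l in G. exact G. }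
    symmetry. now apply Ceq_minus.
  - apply (ccont_on_v _ _ _ _ _ HF). lra.
  - apply (ccont_on_v _ _ _ _ _ HF). lra.
Qed.

Lemma circle_int_bound h s M : 0 <= s -> (forall w, Cmod w = s -> @ccont Cspace h w) ->
  (forall w, Cmod w = s -> Cmod (h w) <= M) -> Cmod (circle_int h s) <= M * (2 * PI).
Proof.
  intros Hs Hc HM. assert (P := PI2_pos).
  replace (2 * PI) with (2 * PI - 0) at 1 by ring. apply CInt_bound; [lra| |].
  - now apply ccont_comp_circ.
  - intros t _. apply HM. now apply Cmod_circ.
Qed.

(** Serves to carry circle integrals across a circle on which [h] is merely continuous. *)
Lemma circle_int_cont h s0 r1 r2 : 0 <= r1 < s0 -> s0 < r2 ->
  (forall w, r1 < Cmod w < r2 -> @ccont Cspace h w) ->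
  forall eps, 0 < eps -> exists d, 0 < d /\
    forall s, Rabs (s - s0) < d -> Cmod (circle_int h s - circle_int h s0) <= eps.
Proof.
  intros H1 H2 Hc eps He. assert (P := PI2_pos).
  assert (C2 : forall t, @ccont (prod_UniformSpace R_UniformSpace R_UniformSpace)
      (fun z => h (circ (snd z) (fst z))) (t, s0)).
  { intros t. apply (@ccont_comp (prod_UniformSpace R_UniformSpace R_UniformSpace) h
      (fun z => circ (snd z) (fst z))).
    - apply (@ccont_pair (prod_UniformSpace R_UniformSpace R_UniformSpace));
      apply (continuous_mult (U := prod_UniformSpace R_UniformSpace R_UniformSpace) (K := R_AbsRing)).
      + apply continuous_snd.
      + apply (continuous_comp (fst : prod_UniformSpace R_UniformSpace R_UniformSpace -> R) cos);
          [apply continuous_fst|]. apply continuity_pt_filterlim, continuity_cos.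
      + apply continuous_snd.
      + apply (continuous_comp (fst : prod_UniformSpace R_UniformSpace R_UniformSpace -> R) sin);
          [apply continuous_fst|]. apply continuity_pt_filterlim, continuity_sin.
    - apply Hc. simpl. rewrite Cmod_circ; lra. }
  (* One factor 2 for the real and imaginary parts, and $2\pi$ for the length of the interval. *)
  set (k := eps / (2 * (2 * PI))).
  assert (Hk : 0 < k) by (apply Rdiv_lt_0_compat; lra).
  destruct (uniform_continuity_2d_1d (fun t s => Re (h (circ s t))) 0 (2 * PI) s0) with (eps := mkposreal k Hk)
    as [d1 K1].
  { intros t _. apply continuity_2d_pt_filterlim.
    exact (@ccont_Re (prod_UniformSpace R_UniformSpace R_UniformSpace) _ _ (C2 t)). }
  destruct (uniform_continuity_2d_1d (fun t s => Im (h (circ s t))) 0 (2 * PI) s0) with (eps := mkposreal k Hk)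
    as [d2 K2].
  { intros t _. apply continuity_2d_pt_filterlim.
    exact (@ccont_Im (prod_UniformSpace R_UniformSpace R_UniformSpace) _ _ (C2 t)). }
  set (d := Rmin (Rmin d1 d2) (Rmin (s0 - r1) (r2 - s0))).
  assert (D : 0 < d /\ d <= d1 /\ d <= d2 /\ d <= s0 - r1 /\ d <= r2 - s0).
  { split.
    - unfold d. repeat apply Rmin_pos; try apply cond_pos; lra.
    - unfold d. generalize (Rmin_l (Rmin d1 d2) (Rmin (s0 - r1) (r2 - s0)))
       (Rmin_r (Rmin d1 d2) (Rmin (s0 - r1) (r2 - s0))) (Rmin_l d1 d2) (Rmin_r d1 d2)
       (Rmin_l (s0 - r1) (r2 - s0)) (Rmin_r (s0 - r1) (r2 - s0)). lra. }
  exists d. split; [lra|]. intros s Hs.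
  assert (Hs' := Rabs_def2 _ _ Hs).
  assert (A : ccont_on (fun t => h (circ s t)) 0 (2 * PI)).
  { apply ccont_comp_circ; [lra|]. intros w Hw. apply Hc. lra. }
  assert (B : ccont_on (fun t => h (circ s0 t)) 0 (2 * PI)).
  { apply ccont_comp_circ; [lra|]. intros w Hw. apply Hc. lra. }
  unfold circle_int. rewrite <- CInt_minus; auto; [|lra].
  replace eps with ((2 * k) * (2 * PI - 0)) by (unfold k; field; lra).
  apply CInt_bound; [lra|now apply ccont_on_minus|].
  intros t Ht. eapply Rle_trans; [apply Cmod_le_ReIm|].
  assert (R0 : Rabs (t - t) < d) by (unfold Rminus; rewrite Rplus_opp_r, Rabs_R0; lra).
  specialize (K1 t s0 t s Ht ltac:(lra) Ht ltac:(lra) ltac:(lra)).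
  specialize (K2 t s0 t s Ht ltac:(lra) Ht ltac:(lra) ltac:(lra)).
  simpl in K1, K2.
  replace (Re (h (circ s t) - h (circ s0 t))%C) with (Re (h (circ s t)) - Re (h (circ s0 t))) by reflexivity.
  replace (Im (h (circ s t) - h (circ s0 t))%C) with (Im (h (circ s t)) - Im (h (circ s0 t))) by reflexivity.
  lra.
Qed.

Lemma Ceq_of_small (x y : C) : (forall e, 0 < e -> Cmod (x - y) <= e) -> x = y.
Proof.
  intros H. apply Ceq_minus, Cmod_eq_0, Rle_antisym; [|apply Cmod_ge_0].
  apply le_epsilon. intros e He. rewrite Rplus_0_l. now apply H.
Qed.

(** The integral is constant on either side of the exceptional circle, and continuity in the radius
    glues both values to the one at [rho]. The circle is the one through the point z of Cauchy's
    formula, where the difference quotient is only known to be continuous. *)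
Lemma circle_int_const_exc h rho s : 0 < rho < 1 -> 0 < s < 1 ->
  (forall w, 0 < Cmod w < 1 -> @ccont Cspace h w) ->
  (forall w, 0 < Cmod w < 1 -> Cmod w <> rho -> hol h w) ->
  circle_int h s = circle_int h rho.
Proof.
  intros Hr Hs Hc Hh. apply Ceq_of_small. intros e He.
  destruct (circle_int_cont h rho 0 1 ltac:(lra) ltac:(lra) Hc e He) as (d & Hd & K).
  destruct (Rtotal_order s rho) as [L|[->|L]].
  - set (s' := Rmax s (rho - d / 2)).
    assert (s <= s' /\ rho - d / 2 <= s' /\ s' < rho).
    { unfold s'. split; [apply Rmax_l|split; [apply Rmax_r|apply Rmax_lub_lt; lra]]. }
    rewrite (circle_int_const h s s') by (try (intros w Hw; apply Hh); lra).
    apply K. apply Rabs_def1; lra.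
  - replace (circle_int h rho - circle_int h rho)%C with (RtoC 0) by ring. rewrite Cmod_0. lra.
  - set (s' := Rmin s (rho + d / 2)).
    assert (s' <= s /\ s' <= rho + d / 2 /\ rho < s').
    { unfold s'. split; [apply Rmin_l|split; [apply Rmin_r|apply Rmin_glb_lt; lra]]. }
    rewrite <- (circle_int_const h s' s) by (try (intros w Hw; apply Hh); lra).
    apply K. apply Rabs_def1; lra.
Qed.

(** The radius may grow without changing the integral, and at infinity the integrand tends to 1. *)
Lemma circle_int_kernel r z : Cmod z < r ->
  circle_int (fun w => w / (w - z))%C r = RtoC (2 * PI).
Proof.
  intros Hz. assert (P := PI2_pos). assert (z0 := Cmod_ge_0 z). set (m := Cmod z) in *.
  assert (HH : forall w, m < Cmod w -> hol (fun w => w / (w - z))%C w).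
  { intros w Hw. apply hol_div; [now apply Csub_ne0|apply hol_id|].
    apply hol_minus; [apply hol_id|apply hol_const]. }
  apply Ceq_of_small. intros e He.
  (* Then $s-m\ge 2\pi m/e$, which makes the error $2\pi m/(s-m)$ at most [e]. *)
  set (s := r + m * (2 * PI) / e).
  assert (Q : 0 <= m * (2 * PI) / e) by (apply Rdiv_le_0_compat; nra).
  rewrite (circle_int_const _ r s); [|lra|unfold s; lra|intros w Hw; apply HH; lra].
  assert (S1 : r <= s) by (unfold s; lra).
  replace (RtoC (2 * PI)) with (circle_int (fun _ => RtoC 1) s).
  2:{ unfold circle_int. rewrite CInt_const by lra. rewrite Rminus_0_r. ring. }
  unfold circle_int. rewrite <- CInt_minus.
  - change (Cmod (circle_int (fun w => w / (w - z) - 1)%C s) <= e).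
    eapply Rle_trans; [apply circle_int_bound with (M := m / (s - m))|].
    + lra.
    + intros w Hw. apply hol_ccont, hol_minus; [apply HH; lra|apply hol_const].
    + intros w Hw. assert (N : (w - z)%C <> RtoC 0) by (apply Csub_ne0; fold m; lra).
      replace (w / (w - z) - 1)%C with (z / (w - z))%C by (field; auto).
      rewrite Cmod_div by auto. fold m. apply Rmult_le_compat_l; auto.
      apply Rinv_le_contravar; [lra|]. rewrite <- Hw. apply Cmod_sub_ge.
    + apply (Rmult_le_reg_r (s - m)); [lra|].
      replace (m / (s - m) * (2 * PI) * (s - m)) with (m * (2 * PI)) by (field; lra).
      apply Rle_trans with (e * (m * (2 * PI) / e)); [right; field; lra|].
      apply Rmult_le_compat_l; [lra|]. unfold s. lra.
  - lra.
  - apply (ccont_comp_circ (fun w => w / (w - z))%C); [lra|]. intros w Hw. apply hol_ccont, HH. lra.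
  - intros t _. apply ccont_const.
Qed.

(** The regularity available for a Schur iterate before its singularity at 0 is known to be
    removable. *)
Definition hol_punctured (f : C -> C) :=
  (forall w, 0 < Cmod w < 1 -> hol f w) /\ @ccont Cspace f (RtoC 0).

Lemma hol_punctured_ccont f w : hol_punctured f -> Cmod w < 1 -> @ccont Cspace f w.
Proof.
  intros [H K] Hw. destruct (Ceq_dec w 0) as [->|N]; auto.
  apply hol_ccont, H. split; auto. now apply Cmod_gt_0.
Qed.

(** For [z = 0] the kernel cancels and the radius shrinks to 0, using only continuity there.
    Otherwise [phi] is the difference quotient of [f] at [z]: the circle integral of [w * phi w] is
    independent of the radius and vanishes, which splits into the formula and the kernel
    integral. *)
Theorem cauchy_formula f r z : hol_punctured f -> Cmod z < r -> r < 1 ->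
  circle_int (fun w => w * f w / (w - z))%C r = (RtoC (2 * PI) * f z)%C.
Proof.
  intros Hf Hz Hr. assert (P := PI2_pos). assert (z0 := Cmod_ge_0 z).
  assert (Hf' := Hf). destruct Hf' as [Hh Hc].
  destruct (Ceq_dec z 0) as [->|N].
  - rewrite Cmod_0 in *.
    rewrite (circle_int_ext _ f) by (try lra; intros w Hw; field; apply Cmod_ne0; lra).
    apply Ceq_of_small. intros e He.
    destruct (proj1 (locally_Cmod _ _) (Hc (e / (2 * PI)) ltac:(apply Rdiv_lt_0_compat; lra))) as (d & Hd & K).
    set (s := Rmin r (d / 2)).
    assert (S : 0 < s /\ s <= r /\ s <= d / 2).
    { split; [apply Rmin_pos; lra|split; [apply Rmin_l|apply Rmin_r]]. }
    rewrite <- (circle_int_const f s r) by (try (intros w Hw; apply Hh); lra).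
    replace (RtoC (2 * PI) * f 0)%C with (circle_int (fun _ => f (RtoC 0)) s).
    2:{ unfold circle_int. rewrite CInt_const by lra. rewrite Rminus_0_r. ring. }
    unfold circle_int. rewrite <- CInt_minus.
    + change (Cmod (circle_int (fun w => f w - f (RtoC 0))%C s) <= e).
      replace e with (e / (2 * PI) * (2 * PI)) by (field; lra).
      apply circle_int_bound; [lra| |].
      * intros w Hw. apply (@ccont_minus Cspace); [|apply ccont_const].
        apply (hol_punctured_ccont f); auto. lra.
      * intros w Hw. left. apply K. replace (w - 0)%C with w by ring. lra.
    + lra.
    + apply ccont_comp_circ; [lra|]. intros w Hw. apply (hol_punctured_ccont f); auto. lra.
    + intros t _. apply ccont_const.
  - assert (zp : 0 < Cmod z) by now apply Cmod_gt_0.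
    destruct (Hh z ltac:(lra)) as [l Hl].
    destruct (proj1 (cdiff_slope f z l) Hl) as (phi & E & _ & Cphi).
    assert (E' : forall w, w <> z -> phi w = ((f w - f z) / (w - z))%C).
    { intros w Hw. rewrite (E w). field. now apply Cminus_eq_contra. }
    assert (Hphi : forall w, w <> z ->
      exists d, 0 < d /\ forall v, Cmod (v - w) < d -> ((f v - f z) / (v - z))%C = phi v).
    { intros w Hw. exists (Cmod (z - w)). split.
      - apply Cmod_gt_0, Cminus_eq_contra. auto.
      - intros v Hv. symmetry. apply E'. intros ->. lra. }
    assert (Hol : forall w, 0 < Cmod w < 1 -> w <> z -> hol phi w).
    { intros w H1 H2. apply hol_ext_loc with (fun v => (f v - f z) / (v - z))%C.
      - now apply Hphi.
      - apply hol_div; [now apply Cminus_eq_contra| |].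
        + apply hol_minus; [now apply Hh|apply hol_const].
        + apply hol_minus; [apply hol_id|apply hol_const]. }
    assert (Ch : forall w, Cmod w < 1 -> @ccont Cspace (fun w => w * phi w)%C w).
    { intros w Hw. apply (@ccont_mult Cspace); [apply ccont_id|].
      destruct (Ceq_dec w z) as [->|Nw]; auto.
      apply (@ccont_ext_loc Cspace) with (fun v => (f v - f z) / (v - z))%C.
      - apply locally_Cmod. now apply Hphi.
      - apply (@ccont_div Cspace); [now apply Cminus_eq_contra| |].
        + apply (@ccont_minus Cspace); [now apply hol_punctured_ccont|apply ccont_const].
        + apply (@ccont_minus Cspace); [apply ccont_id|apply ccont_const]. }
    assert (J : forall s, 0 < s < 1 ->
      circle_int (fun w => w * phi w)%C s = circle_int (fun w => w * phi w)%C (Cmod z)).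
    { intros s Hs. apply circle_int_const_exc; auto; [lra|intros; apply Ch; lra|].
      intros w Hw Nw. apply hol_mult; [apply hol_id|]. apply Hol; auto. intros ->. auto. }
    (* The factor [w] makes the integrand small on small circles. *)
    assert (J0 : circle_int (fun w => w * phi w)%C (Cmod z) = RtoC 0).
    { apply Ceq_of_small. intros e He.
      destruct (proj1 (locally_Cmod _ _) (Ch (RtoC 0) ltac:(rewrite Cmod_0; lra) (e / (2 * PI))
         ltac:(apply Rdiv_lt_0_compat; lra))) as (d & Hd & K).
      set (s := Rmin (1 / 2) (d / 2)).
      assert (S : 0 < s /\ s <= 1 / 2 /\ s <= d / 2).
      { split; [apply Rmin_pos; lra|split; [apply Rmin_l|apply Rmin_r]]. }
      rewrite <- (J s) by lra. replace (circle_int (fun w => w * phi w)%C s - 0)%C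
        with (circle_int (fun w => w * phi w)%C s) by ring.
      replace e with (e / (2 * PI) * (2 * PI)) by (field; lra).
      apply circle_int_bound; [lra| |].
      - intros w Hw. apply Ch. lra.
      - intros w Hw. left. replace (w * phi w)%C with (w * phi w - 0 * phi 0)%C by ring.
        apply K. replace (w - 0)%C with w by ring. lra. }
    rewrite <- (J r) in J0 by lra.
    rewrite (circle_int_ext _ (fun w => w * f w / (w - z) - f z * (w / (w - z)))%C) in J0.
    2: lra.
    2:{ intros w Hw. assert (Q : (w - z)%C <> RtoC 0) by (apply Csub_ne0; lra).
        rewrite E'; [field; auto|]. intros ->. lra. }
    assert (Ck : forall w, Cmod w = r -> @ccont Cspace (fun w => w / (w - z))%C w).
    { intros w Hw. apply (@ccont_div Cspace); [apply Csub_ne0; lra|apply ccont_id|].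
      apply (@ccont_minus Cspace); [apply ccont_id|apply ccont_const]. }
    unfold circle_int in J0. rewrite CInt_minus in J0.
    + rewrite CInt_scal in J0; [|lra|now apply (ccont_comp_circ (fun w => w / (w - z))%C); [lra|]].
      fold (circle_int (fun w => w / (w - z))%C r) in J0. rewrite circle_int_kernel in J0 by auto.
      apply Ceq_minus. rewrite <- J0. unfold circle_int. ring.
    + lra.
    + apply (ccont_comp_circ (fun w => w * f w / (w - z))%C); [lra|]. intros w Hw.
      apply (@ccont_div Cspace); [apply Csub_ne0; lra| |].
      * apply (@ccont_mult Cspace); [apply ccont_id|]. apply hol_punctured_ccont; auto. lra.
      * apply (@ccont_minus Cspace); [apply ccont_id|apply ccont_const].
    + apply (ccont_comp_circ (fun w => f z * (w / (w - z)))%C); [lra|]. intros w Hw.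
      apply (@ccont_mult Cspace); [apply ccont_const|now apply Ck].
Qed.

(** * Removable singularities, locally uniform limits, maximum modulus *)

Lemma circle_bounded h s : 0 <= s -> (forall w, Cmod w = s -> @ccont Cspace h w) ->
  exists M, 0 < M /\ forall t, 0 <= t <= 2 * PI -> Cmod (h (circ s t)) <= M.
Proof.
  intros Hs Hc. assert (P := PI2_pos).
  destruct (continuity_ab_maj (fun t => Cmod (h (circ s t))) 0 (2 * PI)) as (x & Hx & _); [lra| |].
  - intros t Ht. apply continuity_pt_filterlim, (@ccont_Cmod R_UniformSpace).
    now apply (ccont_comp_circ h s Hs Hc).
  - exists (Cmod (h (circ s x)) + 1). split; [generalize (Cmod_ge_0 (h (circ s x))); lra|].
    intros t Ht. generalize (Hx t Ht). lra.
Qed.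

(** Differentiation under the integral with an exact remainder: with $h=v-z$, the kernel $1/(w-v)$
    differs from its first-order expansion at z by $h^2/((w-z)^2(w-v))$. *)
Lemma hol_cauchy_transform g r z : 0 < r -> Cmod z < r ->
  (forall w, Cmod w = r -> @ccont Cspace g w) ->
  hol (fun z => circle_int (fun w => g w / (w - z))%C r) z.
Proof.
  intros Hr Hz Hg. assert (P := PI2_pos).
  assert (Cz : forall z w, Cmod z < r -> Cmod w = r -> @ccont Cspace (fun w => g w / (w - z))%C w).
  { intros v w Hv Hw. apply (@ccont_div Cspace); [apply Csub_ne0; lra|auto|].
    apply (@ccont_minus Cspace); [apply ccont_id|apply ccont_const]. }
  assert (Cz2 : forall w, Cmod w = r -> @ccont Cspace (fun w => g w / ((w - z) * (w - z)))%C w).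
  { intros w Hw. assert (N : (w - z)%C <> RtoC 0) by (apply Csub_ne0; lra).
    apply (@ccont_div Cspace); [now apply Cmult_neq_0|auto|].
    apply (@ccont_mult Cspace); (apply (@ccont_minus Cspace); [apply ccont_id|apply ccont_const]). }
  destruct (circle_bounded g r ltac:(lra) Hg) as (M & HM & B).
  exists (circle_int (fun w => g w / ((w - z) * (w - z)))%C r).
  (* [k] bounds the distance from [z] to the circle from below. For [v] within [k / 2] of [z] the
     remainder kernel is at most $M/(k^2\cdot k/2)$, which gives [T]. *)
  intros e He. set (k := r - Cmod z). assert (Hk : 0 < k) by (unfold k; lra).
  set (T := 2 * M / (k * k * k) * (2 * PI)).
  assert (HT : 0 < T).
  { apply Rmult_lt_0_compat; auto. apply Rdiv_lt_0_compat; [lra|].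
    repeat apply Rmult_lt_0_compat; auto. }
  set (d := Rmin (k / 2) (e / T)).
  assert (Hd : 0 < d) by (apply Rmin_pos; [lra|now apply Rdiv_lt_0_compat]).
  assert (d1 : d <= k / 2) by apply Rmin_l. assert (d2 : d <= e / T) by apply Rmin_r.
  exists d. split; auto. intros v Hv. set (h := (v - z)%C) in *.
  assert (Hv' : Cmod v <= Cmod z + k / 2).
  { replace v with (z + h)%C by (unfold h; ring). eapply Rle_trans; [apply Cmod_triangle|lra]. }
  assert (Hvr : Cmod v < r) by (unfold k in *; lra).
  assert (E : (circle_int (fun w => g w / (w - v)) r - circle_int (fun w => g w / (w - z)) r
     - circle_int (fun w => g w / ((w - z) * (w - z))) r * h)%C =
     (h * h * circle_int (fun w => g w / ((w - z) * (w - z) * (w - v))) r)%C).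
  { unfold circle_int. rewrite (Cmult_comm _ h).
    assert (A1 := ccont_comp_circ _ r ltac:(lra) (fun w => Cz v w Hvr)).
    assert (A2 := ccont_comp_circ _ r ltac:(lra) (fun w => Cz z w Hz)).
    assert (A3 := ccont_comp_circ _ r ltac:(lra) Cz2).
    cbv beta in A1, A2, A3.
    rewrite <- (CInt_scal 0 (2 * PI) ltac:(lra) h) by exact A3.
    rewrite <- (CInt_minus 0 (2 * PI) ltac:(lra) _ _ A1 A2).
    rewrite <- (CInt_minus 0 (2 * PI) ltac:(lra)).
    2: exact (ccont_on_minus _ _ _ _ A1 A2).
    2:{ intros t Ht. apply (@ccont_mult R_UniformSpace); [apply ccont_const|now apply A3]. }
    rewrite <- (CInt_scal 0 (2 * PI) ltac:(lra) (h * h)%C).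
    2:{ intros t _. apply (@ccont_comp R_UniformSpace (fun w => g w / ((w - z) * (w - z) * (w - v)))%C (circ r));
        [apply ccont_circ|].
        assert (Hw : Cmod (circ r t) = r) by (apply Cmod_circ; lra).
        assert (N : (circ r t - z)%C <> RtoC 0) by (apply Csub_ne0; lra).
        assert (N' : (circ r t - v)%C <> RtoC 0) by (apply Csub_ne0; lra).
        apply (@ccont_div Cspace); [repeat apply Cmult_neq_0; auto|auto|].
        apply (@ccont_mult Cspace); [apply (@ccont_mult Cspace)|];
        (apply (@ccont_minus Cspace); [apply ccont_id|apply ccont_const]). }
    apply CInt_ext; [lra|]. intros t _.
    assert (Hw : Cmod (circ r t) = r) by (apply Cmod_circ; lra).
    assert (N : (circ r t - z)%C <> RtoC 0) by (apply Csub_ne0; lra).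
    assert (N' : (circ r t - v)%C <> RtoC 0) by (apply Csub_ne0; lra).
    unfold h. field. auto. }
  rewrite E, !Cmod_mult.
  assert (Bd : Cmod (circle_int (fun w => g w / ((w - z) * (w - z) * (w - v)))%C r) <= T).
  { unfold T. unfold circle_int. replace (2 * PI) with (2 * PI - 0) at 2 by ring.
    assert (N0 : forall t, k <= Cmod (circ r t - z) /\ k / 2 <= Cmod (circ r t - v)).
    { intros t. assert (Hw : Cmod (circ r t) = r) by (apply Cmod_circ; lra).
      assert (X := Cmod_sub_ge (circ r t) z). assert (Y := Cmod_sub_ge (circ r t) v).
      unfold k in *. lra. }
    apply CInt_bound; [lra| |].
    - intros t _. destruct (N0 t) as [X Y].
      assert (N : (circ r t - z)%C <> RtoC 0) by (apply Cmod_ne0; lra).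
      assert (N' : (circ r t - v)%C <> RtoC 0) by (apply Cmod_ne0; lra).
      apply (@ccont_comp R_UniformSpace (fun w => g w / ((w - z) * (w - z) * (w - v)))%C (circ r));
      [apply ccont_circ|].
      apply (@ccont_div Cspace); [repeat apply Cmult_neq_0; auto|apply Hg, Cmod_circ; lra|].
      apply (@ccont_mult Cspace); [apply (@ccont_mult Cspace)|];
      (apply (@ccont_minus Cspace); [apply ccont_id|apply ccont_const]).
    - intros t Ht. destruct (N0 t) as [X Y].
      assert (N : (circ r t - z)%C <> RtoC 0) by (apply Cmod_ne0; lra).
      assert (N' : (circ r t - v)%C <> RtoC 0) by (apply Cmod_ne0; lra).
      rewrite Cmod_div, !Cmod_mult by (repeat apply Cmult_neq_0; auto).
      replace (2 * M / (k * k * k)) with (M / (k * k * (k / 2))) by (field; lra).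
      apply Rmult_le_compat; [apply Cmod_ge_0| |now apply B|].
      + left. apply Rinv_0_lt_compat. repeat apply Rmult_lt_0_compat; lra.
      + apply Rinv_le_contravar; [repeat apply Rmult_lt_0_compat; lra|].
        apply Rmult_le_compat; try lra; [nra|]. nra. }
  assert (X := Cmod_ge_0 h).
  assert (Y : Cmod h * T <= e).
  { replace e with (e / T * T) by (field; lra). apply Rmult_le_compat_r; lra. }
  assert (Z : Cmod h * Cmod (circle_int (fun w => g w / ((w - z) * (w - z) * (w - v)))%C r) <= Cmod h * T).
  { now apply Rmult_le_compat_l. }
  rewrite Rmult_assoc, Rmult_comm. apply Rmult_le_compat_r; lra.
Qed.

(** Holomorphy inside follows from the representation alone. It is used twice: for removable
    singularities and for uniform limits. *)
Lemma cauchy_formula_hol f r z : 0 < r -> Cmod z < r ->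
  (forall w, Cmod w = r -> @ccont Cspace f w) ->
  (forall v, Cmod v < r -> circle_int (fun w => w * f w / (w - v))%C r = (RtoC (2 * PI) * f v)%C) ->
  hol f z.
Proof.
  intros Hr Hz Hc H. assert (P := PI2_pos).
  assert (P' : RtoC (2 * PI) <> RtoC 0) by (apply RtoC_ne0; lra).
  apply hol_ext_loc with (fun v => / RtoC (2 * PI) * circle_int (fun w => w * f w / (w - v)) r)%C.
  - exists (r - Cmod z). split; [lra|]. intros w Hw. rewrite H; [now field|].
    replace w with (z + (w - z))%C by ring. eapply Rle_lt_trans; [apply Cmod_triangle|lra].
  - apply hol_mult; [apply hol_const|].
    apply (hol_cauchy_transform (fun w => w * f w)%C); auto.
    intros w Hw. apply (@ccont_mult Cspace); [apply ccont_id|auto].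
Qed.

Definition hol_D (f : C -> C) := forall z, Cmod z < 1 -> hol f z.

Lemma hol_D_punctured f : hol_D f -> hol_punctured f.
Proof.
  intros H. split; [intros w Hw; apply H; lra|]. apply hol_ccont, H. rewrite Cmod_0. lra.
Qed.

Lemma removable_singularity f : hol_punctured f -> hol_D f.
Proof.
  intros H z Hz. assert (Z := Cmod_ge_0 z).
  apply (cauchy_formula_hol f ((1 + Cmod z) / 2)); try lra.
  - intros w Hw. apply hol_punctured_ccont; auto. lra.
  - intros v Hv. apply cauchy_formula; auto. lra.
Qed.

Definition disc_unif_lim (F : nat -> C -> C) (g : C -> C) :=
  forall r eps, 0 < r < 1 -> 0 < eps -> exists N, forall n, (N <= n)%nat ->
    forall z, Cmod z <= r -> Cmod (F n z - g z) < eps.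

Lemma disc_unif_lim_ccont F g z : (forall n, hol_D (F n)) -> disc_unif_lim F g -> Cmod z < 1 ->
  @ccont Cspace g z.
Proof.
  intros HF HL Hz e He. assert (Z := Cmod_ge_0 z). set (r := (1 + Cmod z) / 2).
  destruct (HL r (e / 3) ltac:(unfold r; lra) ltac:(lra)) as [N HN].
  specialize (HN N (Nat.le_refl _)).
  destruct (proj1 (locally_Cmod _ _) (hol_ccont _ _ (HF N z Hz) (e / 3) ltac:(lra))) as (d & Hd & K).
  apply locally_Cmod. exists (Rmin d (r - Cmod z)). split.
  - apply Rmin_pos; unfold r; lra.
  - intros w Hw. assert (D1 := Rmin_l d (r - Cmod z)). assert (D2 := Rmin_r d (r - Cmod z)).
    specialize (K w ltac:(lra)).
    assert (Cmod w <= r).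
    { replace w with (z + (w - z))%C by ring. eapply Rle_trans; [apply Cmod_triangle|lra]. }
    assert (A := HN w ltac:(auto)). assert (B := HN z ltac:(unfold r; lra)).
    assert (T1 := Cmod_sub_triangle (g w) (F N w) (g z)).
    assert (T2 := Cmod_sub_triangle (F N w) (F N z) (g z)).
    rewrite (Cmod_sub_sym (g w) (F N w)) in T1. lra.
Qed.

(** Weierstrass' theorem: Cauchy's formula passes to the uniform limit on a circle. *)
Lemma disc_unif_lim_hol F g : (forall n, hol_D (F n)) -> disc_unif_lim F g -> hol_D g.
Proof.
  intros HF HL z Hz. assert (Z := Cmod_ge_0 z). assert (P := PI2_pos).
  assert (Cg := fun z => disc_unif_lim_ccont F g z HF HL).
  set (r := (1 + Cmod z) / 2). assert (Hr : 0 < r < 1) by (unfold r; lra).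
  apply (cauchy_formula_hol g r); try (unfold r; lra).
  { intros w Hw. apply Cg. lra. }
  intros v Hv. set (k := r - Cmod v). assert (Hk : 0 < k) by (unfold k; lra).
  apply Ceq_of_small. intros e He.
  (* The first bound controls the value at [v], the second the circle integral, whose kernel is at
     most [r / k]; each gets half of [e]. *)
  set (eta := Rmin (e / (2 * (2 * PI))) (e * k / (2 * r * (2 * PI)))).
  assert (Heta : 0 < eta).
  { apply Rmin_pos; apply Rdiv_lt_0_compat; try lra.
    - now apply Rmult_lt_0_compat.
    - apply Rmult_lt_0_compat; lra. }
  assert (E1 : eta <= e / (2 * (2 * PI))) by apply Rmin_l.
  assert (E2 : eta <= e * k / (2 * r * (2 * PI))) by apply Rmin_r.
  destruct (HL r eta Hr Heta) as [N HN]. specialize (HN N (Nat.le_refl _)).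
  assert (CF := cauchy_formula (F N) r v (hol_D_punctured _ (HF N)) Hv ltac:(lra)).
  assert (Ck : forall h w, Cmod w = r -> @ccont Cspace h w -> @ccont Cspace (fun w => w * h w / (w - v))%C w).
  { intros h w Hw Hh. apply (@ccont_div Cspace); [apply Csub_ne0; lra| |].
    - apply (@ccont_mult Cspace); [apply ccont_id|auto].
    - apply (@ccont_minus Cspace); [apply ccont_id|apply ccont_const]. }
  assert (CN : forall w, Cmod w = r -> @ccont Cspace (F N) w).
  { intros w Hw. apply hol_ccont, HF. lra. }
  assert (Cgr : forall w, Cmod w = r -> @ccont Cspace g w) by (intros w Hw; apply Cg; lra).
  assert (D : Cmod (circle_int (fun w => w * F N w / (w - v))%C r - circle_int (fun w => w * g w / (w - v))%C r)
     <= r * eta / k * (2 * PI)).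
  { unfold circle_int. rewrite <- CInt_minus.
    - change (Cmod (circle_int (fun w => w * F N w / (w - v) - w * g w / (w - v))%C r) <= r * eta / k * (2 * PI)).
      apply circle_int_bound; [lra| |].
      + intros w Hw. apply (@ccont_minus Cspace); now apply Ck; auto.
      + intros w Hw. assert (Q : (w - v)%C <> RtoC 0) by (apply Csub_ne0; lra).
        replace (w * F N w / (w - v) - w * g w / (w - v))%C with (w * (F N w - g w) / (w - v))%C by (field; auto).
        rewrite Cmod_div, Cmod_mult, Hw by auto.
        apply Rmult_le_compat.
        * apply Rmult_le_pos; [lra|apply Cmod_ge_0].
        * left. apply Rinv_0_lt_compat. now apply Cmod_gt_0.
        * apply Rmult_le_compat_l; [lra|]. left. apply HN. lra.
        * apply Rinv_le_contravar; [lra|]. unfold k. rewrite <- Hw. apply Cmod_sub_ge.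
    - lra.
    - apply (ccont_comp_circ (fun w => w * F N w / (w - v))%C); [lra|]. intros w Hw. now apply Ck; auto.
    - apply (ccont_comp_circ (fun w => w * g w / (w - v))%C); [lra|]. intros w Hw. now apply Ck; auto. }
  rewrite CF in D.
  assert (D2 : r * eta / k * (2 * PI) <= e / 2).
  { apply Rle_trans with (r * (e * k / (2 * r * (2 * PI))) / k * (2 * PI)).
    - unfold Rdiv at 1 3. apply Rmult_le_compat_r; [lra|].
      apply Rmult_le_compat_r; [left; now apply Rinv_0_lt_compat|]. apply Rmult_le_compat_l; lra.
    - right. field. lra. }
  assert (D3 : Cmod (RtoC (2 * PI) * F N v - RtoC (2 * PI) * g v) <= e / 2).
  { replace (RtoC (2 * PI) * F N v - RtoC (2 * PI) * g v)%C with (RtoC (2 * PI) * (F N v - g v))%C by ring.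
    rewrite Cmod_mult, Cmod_R, Rabs_right by lra.
    assert (A := HN v ltac:(lra)).
    apply Rle_trans with (2 * PI * (e / (2 * (2 * PI)))); [apply Rmult_le_compat_l; lra|].
    right. field. lra. }
  assert (T := Cmod_sub_triangle (circle_int (fun w => w * g w / (w - v))%C r) (RtoC (2 * PI) * F N v) (RtoC (2 * PI) * g v)).
  rewrite (Cmod_sub_sym _ (RtoC (2 * PI) * F N v)) in T. lra.
Qed.

Lemma disc_unif_cauchy_lim (F : nat -> C -> C) :
  (forall r eps, 0 < r < 1 -> 0 < eps -> exists N, forall n m, (N <= n)%nat -> (N <= m)%nat ->
    forall z, Cmod z <= r -> Cmod (F n z - F m z) < eps) ->
  exists g, disc_unif_lim F g.
Proof.
  intros H.
  (* [Lim_seq] is total, so [g] has values off the disc too; nothing is claimed about them. *)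
  set (g := fun z => (real (Lim_seq (fun n => Re (F n z))), real (Lim_seq (fun n => Im (F n z)))) : C).
  exists g.
  assert (HC : forall z, Cmod z < 1 -> is_lim_seq (fun n => Re (F n z)) (Re (g z)) /\
                                       is_lim_seq (fun n => Im (F n z)) (Im (g z))).
  { intros z Hz. assert (Z := Cmod_ge_0 z).
    split; apply Lim_seq_correct', ex_lim_seq_cauchy_corr; intros eps;
    destruct (H ((1 + Cmod z) / 2) eps ltac:(lra) (cond_pos eps)) as [N HN]; exists N; intros n m Hn Hm;
    specialize (HN n m Hn Hm z ltac:(lra)); eapply Rle_lt_trans; try exact HN.
    - apply (re_le_Cmod (F n z - F m z)).
    - apply (im_le_Cmod (F n z - F m z)). }
  intros r eps Hr He. destruct (H r (eps / 4) Hr ltac:(lra)) as [N HN]. exists N.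
  intros n Hn z Hz. destruct (HC z ltac:(lra)) as [L1 L2].
  apply is_lim_seq_spec in L1. apply is_lim_seq_spec in L2.
  assert (E : 0 < eps / 4) by lra.
  destruct (L1 (mkposreal _ E)) as [N1 K1]. destruct (L2 (mkposreal _ E)) as [N2 K2].
  (* The auxiliary index may depend on [z]; the uniform Cauchy bound then removes it. *)
  set (m := (N + (N1 + N2))%nat).
  assert (K1' : Rabs (Re (F m z) - Re (g z)) < eps / 4) by (apply K1; unfold m; lia).
  assert (K2' : Rabs (Im (F m z) - Im (g z)) < eps / 4) by (apply K2; unfold m; lia).
  specialize (HN n m Hn ltac:(unfold m; lia) z Hz).
  assert (T := Cmod_sub_triangle (F n z) (F m z) (g z)).
  assert (Q := Cmod_le_ReIm (F m z - g z)).
  change (Re (F m z - g z)%C) with (Re (F m z) - Re (g z)) in Q.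
  change (Im (F m z - g z)%C) with (Im (F m z) - Im (g z)) in Q. lra.
Qed.

(* Landau's trick: apply the crude Cauchy estimate to [g ^ n] and take n-th roots. *)
Lemma max_modulus g r M z : hol_D g -> Cmod z < r < 1 ->
  (forall w, Cmod w = r -> Cmod (g w) <= M) -> Cmod (g z) <= M.
Proof.
  intros Hg [Hz Hr] HM. assert (Z := Cmod_ge_0 z). assert (P := PI2_pos).
  assert (M0 : 0 <= M).
  { eapply Rle_trans; [apply Cmod_ge_0|]. apply (HM (RtoC r)). rewrite Cmod_R, Rabs_right; lra. }
  apply Rnot_lt_le. intros Hlt. set (G := Cmod (g z)) in *.
  (* A positive number between [M] and [G], so that dividing by it is safe even if [M = 0]. *)
  set (M' := (M + G) / 2). assert (Q : M <= M' /\ 0 < M' < G) by (unfold M'; lra).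
  set (k := r - Cmod z). assert (Hk : 0 < k) by (unfold k; lra).
  assert (B : forall n, (G / M') ^ n <= r / k).
  { intros n.
    assert (Hp : hol_D (fun w => g w ^ n)%C) by (intros w Hw; now apply hol_pow, Hg).
    assert (CF := cauchy_formula _ r z (hol_D_punctured _ Hp) Hz Hr).
    cbv beta in CF.
    assert (E : Cmod (circle_int (fun w => w * (g w ^ n) / (w - z))%C r) <= r * M' ^ n / k * (2 * PI)).
    { apply circle_int_bound; [lra| |].
      - intros w Hw. apply (@ccont_div Cspace); [apply Csub_ne0; lra| |].
        + apply (@ccont_mult Cspace); [apply ccont_id|]. apply hol_ccont, Hp. lra.
        + apply (@ccont_minus Cspace); [apply ccont_id|apply ccont_const].
      - intros w Hw. assert (X : (w - z)%C <> RtoC 0) by (apply Csub_ne0; lra).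
        rewrite Cmod_div, Cmod_mult, Cmod_pow, Hw by auto.
        apply Rmult_le_compat.
        + apply Rmult_le_pos; [lra|apply pow_le, Cmod_ge_0].
        + left. apply Rinv_0_lt_compat. now apply Cmod_gt_0.
        + apply Rmult_le_compat_l; [lra|]. apply pow_incr. split; [apply Cmod_ge_0|].
          eapply Rle_trans; [now apply HM|lra].
        + apply Rinv_le_contravar; [lra|]. unfold k. rewrite <- Hw. apply Cmod_sub_ge. }
    rewrite CF, Cmod_mult, Cmod_R, Rabs_right, Cmod_pow in E by lra.
    assert (MP : 0 < M' ^ n) by (apply pow_lt; lra).
    unfold Rdiv at 1. rewrite Rpow_mult_distr, pow_inv.
    apply (Rmult_le_reg_r (M' ^ n)); auto. rewrite Rmult_assoc, Rinv_l by lra.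
    apply (Rmult_le_reg_l (2 * PI)); auto. fold G in E.
    replace (2 * PI * (r / k * M' ^ n)) with (r * M' ^ n / k * (2 * PI)) by (field; lra). lra. }
  destruct (Pow_x_infinity (G / M')) with (b := r / k + 1) as [N HN].
  - rewrite Rabs_right.
    + apply (Rmult_lt_reg_r M'); [lra|]. replace (G / M' * M') with G by (field; lra). lra.
    + apply Rle_ge, Rdiv_le_0_compat; lra.
  - specialize (HN N (Nat.le_refl _)). specialize (B N).
    rewrite Rabs_right in HN; [lra|]. apply Rle_ge, pow_le, Rdiv_le_0_compat; lra.
Qed.

(* Schwarz's lemma for the vector (F, U): it follows from the maximum principle for the
   scalar functions obtained by pairing with a fixed vector. *)
Lemma schwarz_pair F U : hol_D F -> hol_D U ->
  (forall z, Cmod z < 1 -> (Cmod z * Cmod (F z)) ^ 2 + Cmod (U z) ^ 2 <= 1) ->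
  forall z, Cmod z < 1 -> Cmod (F z) ^ 2 + Cmod (U z) ^ 2 <= 1.
Proof.
  intros HF HU H z Hz. assert (Z := Cmod_ge_0 z).
  set (N := Cmod (F z) ^ 2 + Cmod (U z) ^ 2).
  assert (HN : 0 <= N) by (unfold N; nra).
  (* The fixed vector is the value of the pair at [z], so that [G z] has modulus [N], while
     Cauchy-Schwarz and [H] bound [G] by $\sqrt N/r$ on $|w|=r$. *)
  set (G := fun w => (Cconj (F z) * F w + Cconj (U z) * U w)%C).
  assert (HG : hol_D G).
  { intros w Hw. apply hol_plus; (apply hol_mult; [apply hol_const|]); auto. }
  assert (GN : Cmod (G z) = N).
  { unfold G. rewrite !(Cmult_comm (Cconj _)), <- !Cmod2_conj, <- RtoC_plus, Cmod_R.
    apply Rabs_right. fold N. lra. }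
  assert (K : forall r, Cmod z < r < 1 -> 0 < r -> N * r <= sqrt N).
  { intros r Hr Hr0.
    assert (B : Cmod (G z) <= sqrt N / r).
    { apply (max_modulus G r); auto. intros w Hw.
      apply (Rmult_le_reg_r r); auto. unfold Rdiv. rewrite Rmult_assoc, Rinv_l, Rmult_1_r by lra.
      apply Rsqr_incr_0_var; [|apply sqrt_pos]. rewrite Rsqr_sqrt by auto.
      specialize (H w ltac:(lra)). rewrite Hw in H.
      assert (T := Cmod_triangle (Cconj (F z) * F w) (Cconj (U z) * U w)).
      fold (G w) in T. rewrite !Cmod_mult, !Cmod_conj in T.
      assert (G0 := Cmod_ge_0 (G w)).
      unfold N, Rsqr.
      set (a := Cmod (F z)) in *. set (b := Cmod (U z)) in *.
      set (x := Cmod (F w)) in *. set (y := Cmod (U w)) in *.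
      assert (S1 : Cmod (G w) * Cmod (G w) <= (a * x + b * y) * (a * x + b * y)) by nra.
      assert (S2 : (a * x + b * y) * (a * x + b * y) <= (a ^ 2 + b ^ 2) * (x ^ 2 + y ^ 2)).
      { assert (0 <= (a * y - b * x) ^ 2) by apply pow2_ge_0. nra. }
      assert (S3 : (x ^ 2 + y ^ 2) * (r * r) <= 1).
      { assert (0 <= y ^ 2) by apply pow2_ge_0. assert (r * r <= 1) by nra. nra. }
      assert (S4 : 0 <= a ^ 2 + b ^ 2) by (unfold a, b; nra).
      replace (Cmod (G w) * r * (Cmod (G w) * r)) with (Cmod (G w) * Cmod (G w) * (r * r)) by ring.
      apply Rle_trans with ((a ^ 2 + b ^ 2) * (x ^ 2 + y ^ 2) * (r * r)).
      - apply Rmult_le_compat_r; [nra|lra].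
      - rewrite Rmult_assoc. nra. }
    rewrite GN in B. apply (Rmult_le_compat_r r) in B; [|lra].
    unfold Rdiv in B. rewrite Rmult_assoc, Rinv_l, Rmult_1_r in B by lra. exact B. }
  apply Rnot_lt_le. intros H1.
  assert (SN : sqrt N < N).
  { rewrite <- (sqrt_sqrt N) at 2 by auto.
    assert (1 < sqrt N) by (rewrite <- sqrt_1; apply sqrt_lt_1; lra). nra. }
  (* A radius below 1 and above both $|z|$ and $\sqrt N/N$ contradicts [K]. *)
  set (r := Rmax ((1 + Cmod z) / 2) ((1 + sqrt N / N) / 2)).
  assert (Q : sqrt N / N < 1).
  { apply (Rmult_lt_reg_r N); [lra|]. unfold Rdiv. rewrite Rmult_assoc, Rinv_l; lra. }
  assert (R1 : (1 + Cmod z) / 2 <= r) by apply Rmax_l.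
  assert (R2 : (1 + sqrt N / N) / 2 <= r) by apply Rmax_r.
  assert (R3 : r < 1) by (apply Rmax_lub_lt; lra).
  specialize (K r ltac:(lra) ltac:(lra)).
  assert (sqrt N / N < r) by lra.
  assert (sqrt N < r * N).
  { replace (sqrt N) with (sqrt N / N * N) by (field; lra). apply Rmult_lt_compat_r; lra. }
  lra.
Qed.

(** * Schur algorithm of a non-extreme function *)

Lemma analytic_hol_D f : analytic_on_D f <-> hol_D f.
Proof. split; intros H z Hz; apply ex_derive_cdiff, H, Hz. Qed.

(** Pick's identity for the disc automorphism $w\mapsto(w-g)/(1-\bar g w)$, cleared of
    denominators. *)
Lemma Cmod_sqr_pick (g w : C) :
  Cmod (1 - Cconj g * w) ^ 2 - Cmod (w - g) ^ 2 = (1 - Cmod g ^ 2) * (1 - Cmod w ^ 2).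
Proof.
  rewrite !Cmod2_alt. destruct g, w. unfold Re, Im; simpl. ring.
Qed.

(** The weak inequality is what Schwarz's lemma passes on to the next iterate; strictness at 0 is
    recovered separately in [gamma_lt_1]. *)
Definition bounded_by_1 (f : C -> C) := forall z, Cmod z < 1 -> Cmod (f z) <= 1.

Section SchurStep.
Variable f : C -> C.
Hypothesis Hf : hol_D f.
Hypothesis Bf : bounded_by_1 f.
Hypothesis f0 : Cmod (f (RtoC 0)) < 1.

Let g := f (RtoC 0).

Lemma schur_den_ne0 z : Cmod z < 1 -> (1 - Cconj g * f z)%C <> RtoC 0.
Proof.
  intros Hz. apply Csub_ne0. rewrite Cmod_mult, Cmod_conj, Cmod_1.
  specialize (Bf z Hz). fold g in f0.
  assert (A := Cmod_ge_0 g). assert (B := Cmod_ge_0 (f z)). nra.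
Qed.

Lemma schur_step_eq z : Cmod z < 1 ->
  (f z - g)%C = (z * schur_step f z * (1 - Cconj g * f z))%C.
Proof.
  intros Hz. unfold schur_step. fold g. destruct (Ceq_dec z 0) as [->|N].
  - unfold g. ring.
  - field. split; auto. now apply schur_den_ne0.
Qed.

Lemma schur_step_hol : hol_D (schur_step f).
Proof.
  apply removable_singularity. split.
  - intros w Hw. assert (N : w <> RtoC 0) by (apply Cmod_ne0; lra).
    apply hol_ext_loc with (fun z => / z * ((f z - g) / (1 - Cconj g * f z)))%C.
    + exists (Cmod w). split; [lra|]. intros v Hv. unfold schur_step. fold g.
      destruct (Ceq_dec v 0) as [->|]; [|easy]. exfalso.
      rewrite Cmod_sub_sym in Hv. replace (w - 0)%C with w in Hv by ring. lra.
    + assert (Hw' : hol f w) by (apply Hf; lra).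
      apply hol_mult; [apply hol_inv; auto; apply hol_id|].
      apply hol_div; [apply schur_den_ne0; lra| |].
      * apply hol_minus; auto. apply hol_const.
      * apply hol_minus; [apply hol_const|]. apply hol_mult; auto. apply hol_const.
  - assert (Z : Cmod (RtoC 0) < 1) by (rewrite Cmod_0; lra).
    (* The slope [phi] of [f] at 0 takes the value [C_derive f 0] there, so [phi / (1 - conj g f)]
       is a formula for the step that is continuous across 0. *)
    destruct (proj1 (cdiff_slope _ _ _) (cdiff_C_derive _ _ (Hf (RtoC 0) Z))) as (phi & E & E0 & Cphi).
    apply (@ccont_ext_loc Cspace) with (fun z => phi z / (1 - Cconj g * f z))%C.
    + apply locally_Cmod. exists 1. split; [lra|]. intros w Hw.
      replace (w - 0)%C with w in Hw by ring.
      assert (D := schur_den_ne0 w Hw). unfold schur_step. fold g.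
      destruct (Ceq_dec w 0) as [->|N].
      * now rewrite E0.
      * replace (f w - g)%C with (phi w * w)%C by (rewrite (E w); unfold g; ring). field. auto.
    + apply (@ccont_div Cspace); [now apply schur_den_ne0|auto|].
      apply (@ccont_minus Cspace); [apply ccont_const|].
      apply (@ccont_mult Cspace); [apply ccont_const|]. now apply hol_ccont, Hf.
Qed.

Definition schur_companion (U : C -> C) : C -> C :=
  fun z => (U z * RtoC (sqrt (1 - Cmod g ^ 2)) / (1 - Cconj g * f z))%C.

Lemma schur_companion_hol U : hol_D U -> hol_D (schur_companion U).
Proof.
  intros HU z Hz. apply hol_div; [now apply schur_den_ne0| |].
  - apply hol_mult; auto. apply hol_const.
  - apply hol_minus; [apply hol_const|]. apply hol_mult; [apply hol_const|now apply Hf].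
Qed.

(** Here $k=(1-|g|^2)/|1-\bar g f(z)|^2$. The square root in [schur_companion] is chosen to give the
    companion the very factor that Pick's identity gives to $1-|f|^2$. *)
Lemma schur_gap_scaling z : Cmod z < 1 -> exists k, 0 < k /\
  1 - (Cmod z * Cmod (schur_step f z)) ^ 2 = k * (1 - Cmod (f z) ^ 2) /\
  forall U, Cmod (schur_companion U z) ^ 2 = k * Cmod (U z) ^ 2.
Proof.
  intros Hz. assert (D := schur_den_ne0 z Hz). assert (D' := proj1 (Cmod_gt_0 _) D).
  assert (E := Cmod_sqr_pick g (f z)). rewrite schur_step_eq in E by auto.
  rewrite !Cmod_mult in E.
  assert (G : 0 < 1 - Cmod g ^ 2).
  { fold g in f0. assert (A := Cmod_ge_0 g). nra. }
  unfold schur_companion.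
  set (d := Cmod (1 - Cconj g * f z)) in *.
  exists ((1 - Cmod g ^ 2) / d ^ 2). split; [|split].
  - apply Rdiv_lt_0_compat; auto. now apply pow_lt.
  - apply (Rmult_eq_reg_r (d ^ 2)); [|apply Rgt_not_eq; now apply pow_lt].
    replace ((1 - Cmod g ^ 2) / d ^ 2 * (1 - Cmod (f z) ^ 2) * d ^ 2)
      with ((1 - Cmod g ^ 2) * (1 - Cmod (f z) ^ 2)) by (field; lra).
    rewrite <- E. ring.
  - intros U. rewrite Cmod_div, Cmod_mult, Cmod_R, Rabs_right by (auto; apply Rle_ge, sqrt_pos). fold d.
    rewrite <- (sqrt_sqrt (1 - Cmod g ^ 2)) at 2 by lra. field. lra.
Qed.

(** Common scaling preserves the inequality with $|z|\,|f_{n+1}|$ in place of $|f_{n+1}|$; Schwarz's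
    lemma for pairs removes the factor $|z|$. *)
Lemma schur_pair_step U : hol_D U ->
  (forall z, Cmod z < 1 -> Cmod (f z) ^ 2 + Cmod (U z) ^ 2 <= 1) ->
  forall z, Cmod z < 1 -> Cmod (schur_step f z) ^ 2 + Cmod (schur_companion U z) ^ 2 <= 1.
Proof.
  intros HU H. apply schwarz_pair.
  - apply schur_step_hol.
  - now apply schur_companion_hol.
  - intros z Hz. destruct (schur_gap_scaling z Hz) as (k & Hk & E & EU).
    rewrite EU. specialize (H z Hz). nra.
Qed.

(** The zero companion turns the pair statement into Schwarz's lemma for one function. *)
Lemma schwarz_pick_0 z : Cmod z < 1 -> Cmod (f z - g) <= Cmod z * Cmod (1 - Cconj g * f z).
Proof.
  intros Hz. assert (H := schur_pair_step (fun _ => RtoC 0) (fun w _ => hol_const _ _)).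
  assert (K : Cmod (schur_step f z) ^ 2 + Cmod (schur_companion (fun _ => RtoC 0) z) ^ 2 <= 1).
  { apply H; auto. intros w Hw. rewrite Cmod_0. specialize (Bf w Hw).
    assert (A := Cmod_ge_0 (f w)). nra. }
  rewrite schur_step_eq, !Cmod_mult by auto.
  assert (A := Cmod_ge_0 (schur_step f z)). assert (B := pow2_ge_0 (Cmod (schur_companion (fun _ => RtoC 0) z))).
  assert (L : Cmod (schur_step f z) <= 1) by nra.
  apply Rmult_le_compat_r; [apply Cmod_ge_0|]. assert (Z := Cmod_ge_0 z). nra.
Qed.
End SchurStep.

(* Equality case of the maximum principle at 0, from Schwarz-Pick applied to [s f], [s -> 1]. *)
Lemma unimodular_at_0_const f z : hol_D f -> bounded_by_1 f -> Cmod (f (RtoC 0)) = 1 ->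
  Cmod z < 1 -> f z = f (RtoC 0).
Proof.
  intros Hf Bf H1 Hz. set (g := f (RtoC 0)) in *.
  set (A := Cmod (f z - g)). assert (A0 : 0 <= A) by apply Cmod_ge_0.
  assert (Z := Cmod_ge_0 z).
  assert (K : forall s, 0 < s < 1 -> s * A <= Cmod z * (A + (1 - s * s))).
  { intros s Hs.
    assert (P := schwarz_pick_0 (fun w => RtoC s * f w)%C).
    assert (Q : Cmod (RtoC s * f z - RtoC s * g) <= Cmod z * Cmod (1 - Cconj (RtoC s * g) * (RtoC s * f z))).
    { apply P; auto.
      - intros w Hw. apply hol_mult; [apply hol_const|auto].
      - intros w Hw. rewrite Cmod_mult, Cmod_R, Rabs_right by lra. specialize (Bf w Hw).
        assert (Y := Cmod_ge_0 (f w)). nra.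
      - fold g. rewrite Cmod_mult, Cmod_R, Rabs_right, H1 by lra. lra. }
    replace (RtoC s * f z - RtoC s * g)%C with (RtoC s * (f z - g))%C in Q by ring.
    rewrite Cmod_mult, Cmod_R, Rabs_right in Q by lra. fold A in Q.
    eapply Rle_trans; [exact Q|]. apply Rmult_le_compat_l; auto.
    assert (G1 : (Cconj g * g)%C = RtoC 1).
    { rewrite Cmult_comm, <- Cmod2_conj, H1. f_equal. ring. }
    replace (1 - Cconj (RtoC s * g) * (RtoC s * f z))%C with
      (Cconj g * (g - f z) + RtoC (1 - s * s) * (Cconj g * f z))%C.
    - eapply Rle_trans; [apply Cmod_triangle|]. rewrite !Cmod_mult, Cmod_conj, H1, Cmod_R, Rabs_right by nra.
      rewrite Cmod_sub_sym. fold A. specialize (Bf z Hz).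
      assert (S0 : 0 <= 1 - s * s) by nra. apply (Rmult_le_compat_l _ _ _ S0) in Bf. lra.
    - rewrite Cmult_conj. replace (Cconj (RtoC s)) with (RtoC s) by (apply injective_projections; simpl; ring).
      rewrite RtoC_minus, RtoC_mult.
      transitivity (Cconj g * g - RtoC s * RtoC s * (Cconj g * f z))%C; [ring|]. rewrite G1. ring. }
  apply Ceq_minus, Cmod_eq_0. fold A.
  apply Rle_antisym; auto. apply Rnot_lt_le. intros HA.
  (* With $s=1-d$, [K] yields $(1-|z|)A\le d(A+2)$; [d] is at most half of what this would
     require. *)
  set (d := Rmin (1 / 2) ((1 - Cmod z) * A / (2 * (A + 2)))).
  assert (Hd : 0 < d).
  { apply Rmin_pos; [lra|]. apply Rdiv_lt_0_compat; [|lra]. apply Rmult_lt_0_compat; lra. }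
  assert (d1 : d <= 1 / 2) by apply Rmin_l.
  assert (d2 : d * (2 * (A + 2)) <= (1 - Cmod z) * A).
  { replace ((1 - Cmod z) * A) with ((1 - Cmod z) * A / (2 * (A + 2)) * (2 * (A + 2))) by (field; lra).
    apply Rmult_le_compat_r; [lra|apply Rmin_r]. }
  specialize (K (1 - d) ltac:(lra)).
  assert (X : Cmod z * (1 - (1 - d) * (1 - d)) <= 1 * (2 * d)) by (apply Rmult_le_compat; nra).
  rewrite Rmult_plus_distr_l in K.
  assert (0 < d * (A + 2)) by (apply Rmult_lt_0_compat; lra). nra.
Qed.

(** * Square-summability of the Schur parameters *)

Section SquareSummable.
Variables (f U0 : C -> C) (z0 : C).
Hypothesis Hf : hol_D f.
Hypothesis HU : hol_D U0.
Hypothesis HfU : forall z, Cmod z < 1 -> Cmod (f z) ^ 2 + Cmod (U0 z) ^ 2 <= 1.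
Hypothesis Hz0 : Cmod z0 < 1.
Hypothesis U00 : U0 z0 <> RtoC 0.

Let e n := Cmod (schur_iter f n z0) ^ 2.
Let q := Cmod z0 ^ 2.
Let rho := Cmod (U0 z0) ^ 2 / (1 - e 0%nat).

Lemma e0_lt_1 : e 0%nat < 1.
Proof.
  assert (H := HfU z0 Hz0). apply Cmod_gt_0 in U00. unfold e; simpl schur_iter. nra.
Qed.

Lemma rho_pos : 0 < rho.
Proof.
  assert (H := e0_lt_1). apply Rdiv_lt_0_compat; [|lra]. apply pow_lt. now apply Cmod_gt_0.
Qed.

Lemma bounded_of_pair h V : (forall z, Cmod z < 1 -> Cmod (h z) ^ 2 + Cmod (V z) ^ 2 <= 1) -> bounded_by_1 h.
Proof.
  intros H z Hz. specialize (H z Hz). assert (A := Cmod_ge_0 (h z)).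
  assert (B := pow2_ge_0 (Cmod (V z))). nra.
Qed.

(** A unimodular value at 0 would make [h] a unimodular constant and leave no room for [V] at
    [z0]. *)
Lemma gamma_lt_1 h V : hol_D h -> (forall z, Cmod z < 1 -> Cmod (h z) ^ 2 + Cmod (V z) ^ 2 <= 1) ->
  V z0 <> RtoC 0 -> Cmod (h (RtoC 0)) < 1.
Proof.
  intros Hh H N. assert (B := bounded_of_pair h V H).
  assert (B0 := B (RtoC 0) ltac:(rewrite Cmod_0; lra)).
  destruct (Rle_lt_or_eq_dec _ _ B0) as [L|E]; auto. exfalso.
  assert (Q := unimodular_at_0_const h z0 Hh B E Hz0).
  specialize (H z0 Hz0). rewrite Q, E in H. apply Cmod_gt_0 in N. nra.
Qed.

(** The last clause bounds the ratio $|U_n|^2/(1-|f_n|^2)$ at [z0] from below by its initial value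
    [rho] times a growing factor. The term [e 0] is subtracted because [rho] already accounts for
    it. The clause [U z0 <> 0] is carried along to keep [gamma_lt_1] applicable. *)
Lemma schur_iter_pair n :
  hol_D (schur_iter f n) /\ exists U, hol_D U /\
    (forall z, Cmod z < 1 -> Cmod (schur_iter f n z) ^ 2 + Cmod (U z) ^ 2 <= 1) /\
    U z0 <> RtoC 0 /\
    rho * (1 + (1 - q) * (sum_f_R0 e n - e 0%nat)) * (1 - e n) <= Cmod (U z0) ^ 2.
Proof.
  assert (Hr := rho_pos). assert (He := e0_lt_1).
  assert (Hq : 0 <= q < 1).
  { unfold q. assert (A := Cmod_ge_0 z0). nra. }
  assert (en : forall n, 0 <= e n) by (intros k; apply pow2_ge_0).
  assert (Sn : forall n, 0 <= sum_f_R0 e n - e 0%nat).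
  { intros k. induction k as [|k IH]; simpl; [lra|]. specialize (en (S k)). lra. }
  induction n as [|n (Hn & U & HU' & HP & N & IH)].
  - split; [exact Hf|]. exists U0. repeat split; auto. simpl sum_f_R0.
    unfold rho. right. field. lra.
  - assert (B := bounded_of_pair _ _ HP).
    assert (g1 := gamma_lt_1 _ _ Hn HP N).
    assert (H' := schur_pair_step _ Hn B g1 U HU' HP).
    split; [now apply schur_step_hol|].
    exists (schur_companion (schur_iter f n) U).
    split; [now apply schur_companion_hol|]. split; [exact H'|].
    assert (T : rho * (1 + (1 - q) * (sum_f_R0 e n - e 0%nat)) *
      (1 - (Cmod z0 * Cmod (schur_step (schur_iter f n) z0)) ^ 2) <=
      Cmod (schur_companion (schur_iter f n) U z0) ^ 2).
    { destruct (schur_gap_scaling _ B g1 z0 Hz0) as (k & Hk & E & EU). rewrite E, EU.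
      apply (Rmult_le_compat_l k) in IH; [|lra]. fold (e n). lra. }
    rewrite Rpow_mult_distr in T. fold q in T.
    change (Cmod (schur_step (schur_iter f n) z0) ^ 2) with (e (S n)) in T.
    assert (M := H' z0 Hz0). change (Cmod (schur_step (schur_iter f n) z0) ^ 2) with (e (S n)) in M.
    set (u := Cmod (schur_companion (schur_iter f n) U z0)) in *.
    assert (u0 : 0 <= u) by apply Cmod_ge_0.
    assert (e1 := en (S n)). specialize (Sn n).
    set (X := sum_f_R0 e n - e 0%nat) in *. set (x := e (S n)) in *.
    assert (x1 : x <= 1) by nra.
    assert (QX : 0 <= (1 - q) * X) by nra.
    set (Y := (1 - q) * X) in *.
    assert (qx : q * x < 1) by nra.
    assert (T1 : 0 < rho * (1 + Y) * (1 - q * x)).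
    { apply Rmult_lt_0_compat; [apply Rmult_lt_0_compat; lra|lra]. }
    split.
    + intros E0. unfold u in T. rewrite E0, Cmod_0 in T. lra.
    + eapply Rle_trans; [|exact T].
      change (sum_f_R0 e (S n)) with (sum_f_R0 e n + x).
      replace (1 + (1 - q) * (sum_f_R0 e n + x - e 0%nat)) with (1 + Y + (1 - q) * x) by (unfold Y, X; ring).
      rewrite !Rmult_assoc. apply Rmult_le_compat_l; [lra|].
      (* After the substitution $qx=x-v$ the two sides differ by $v(Y+x)\ge0$. *)
      assert (0 <= (1 - q) * x) by nra. set (v := (1 - q) * x) in *.
      replace (q * x) with (x - v) by (unfold v; ring). nra.
Qed.

(** The ratio never exceeds 1, so its lower bound from [schur_iter_pair] caps the sum. *)
Lemma sum_values_bounded n : sum_f_R0 e n <= 1 + / (rho * (1 - q)).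
Proof.
  assert (Hr := rho_pos). assert (He := e0_lt_1).
  assert (Hq : q < 1).
  { unfold q. assert (A := Cmod_ge_0 z0). nra. }
  destruct (schur_iter_pair n) as (_ & U & _ & HP & N & IH).
  specialize (HP z0 Hz0). fold (e n) in HP. apply Cmod_gt_0 in N.
  assert (en : 0 < 1 - e n) by nra.
  assert (L : rho * (1 + (1 - q) * (sum_f_R0 e n - e 0%nat)) <= 1).
  { apply (Rmult_le_reg_r (1 - e n)); auto. lra. }
  assert (P : 0 < rho * (1 - q)) by (apply Rmult_lt_0_compat; lra).
  assert (sum_f_R0 e n - e 0%nat <= / (rho * (1 - q))); [|lra].
  apply (Rmult_le_reg_l (rho * (1 - q))); auto. rewrite Rinv_r by lra. nra.
Qed.

(** Solving the Schur step at [z0] for gamma_n, with $|1-\bar g w|\le2$, gives $|g|\le|w|+2|v|$;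
    squaring produces the constants 2 and 8. *)
Lemma gamma_sqr_le n :
  Cmod (schur_gamma f n) ^ 2 <= 2 * e n + 8 * e (S n).
Proof.
  destruct (schur_iter_pair n) as (Hn & U & HU' & HP & N & _).
  assert (B := bounded_of_pair _ _ HP).
  assert (g1 := gamma_lt_1 _ _ Hn HP N).
  assert (E := schur_step_eq _ B g1 z0 Hz0).
  unfold schur_gamma, e. simpl schur_iter.
  set (g := schur_iter f n (RtoC 0)) in *. set (w := schur_iter f n z0) in *.
  set (v := schur_step (schur_iter f n) z0) in *.
  assert (L : Cmod g <= Cmod w + 2 * Cmod v).
  { replace g with (w - z0 * v * (1 - Cconj g * w))%C by (rewrite <- E; ring).
    eapply Rle_trans; [apply Cmod_sub_le|]. apply Rplus_le_compat_l.
    rewrite !Cmod_mult.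
    assert (D : Cmod (1 - Cconj g * w) <= 2).
    { eapply Rle_trans; [apply Cmod_sub_le|]. rewrite Cmod_1, Cmod_mult, Cmod_conj.
      specialize (B z0 Hz0). fold w in B. generalize (Cmod_ge_0 g) (Cmod_ge_0 w). nra. }
    assert (X := Cmod_ge_0 v). assert (Y := Cmod_ge_0 (1 - Cconj g * w)). assert (Z := Cmod_ge_0 z0).
    assert (Cmod z0 * Cmod v <= Cmod v) by nra.
    assert (0 <= Cmod z0 * Cmod v) by nra. nra. }
  assert (A := Cmod_ge_0 g). assert (X := Cmod_ge_0 v). assert (Y := Cmod_ge_0 w).
  assert (0 <= (Cmod w - 2 * Cmod v) ^ 2) by apply pow2_ge_0. nra.
Qed.

Lemma schur_square_summable :
  (forall n, hol_D (schur_iter f n) /\ bounded_by_1 (schur_iter f n) /\ Cmod (schur_gamma f n) < 1) /\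
  exists M, forall n, sum_f_R0 (fun k => Cmod (schur_gamma f k) ^ 2) n <= M.
Proof.
  split.
  - intros n. destruct (schur_iter_pair n) as (Hn & U & HU' & HP & N & _).
    split; auto. split; [now apply bounded_of_pair with U|]. now apply gamma_lt_1 with U.
  - exists (10 * (1 + / (rho * (1 - q)))). intros n.
    apply Rle_trans with (sum_f_R0 (fun k => 2 * e k + 8 * e (S k)) n).
    + apply sum_Rle. intros k _. apply gamma_sqr_le.
    + assert (E : sum_f_R0 (fun k => 2 * e k + 8 * e (S k)) n = 2 * sum_f_R0 e n + 8 * (sum_f_R0 e (S n) - e 0%nat)).
      { induction n as [|n IH]; simpl; [ring|]. rewrite IH. simpl. ring. }
      rewrite E. assert (A := sum_values_bounded n). assert (B := sum_values_bounded (S n)).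
      assert (0 <= e 0%nat) by apply pow2_ge_0. lra.
Qed.
End SquareSummable.

(** With $U=m(g-h)$ and $m=\min(t,1-t)$, both $f+U$ and $f-U$ are again convex combinations of g and
    h, hence bounded by 1; the parallelogram law adds the two bounds. *)
Lemma nonextreme_companion f : in_B f -> ~ extreme_B f ->
  exists U z0, hol_D U /\ Cmod z0 < 1 /\ U z0 <> RtoC 0 /\
    forall z, Cmod z < 1 -> Cmod (f z) ^ 2 + Cmod (U z) ^ 2 <= 1.
Proof.
  intros HB HE.
  assert (H : exists (t : R) (g h : C -> C), 0 < t < 1 /\ in_B g /\ in_B h /\
        (exists z : C, inD z /\ g z <> h z) /\
        (forall z : C, inD z -> f z = Cplus (Cmult (RtoC t) (g z)) (Cmult (RtoC (1 - t)) (h z)))).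
  { apply NNPP. intros N. apply HE. now split. }
  destruct H as (t & g & h & Ht & [Hg Bg] & [Hh Bh] & (z0 & Hz0 & N) & E).
  set (m := Rmin t (1 - t)). assert (Hm : 0 < m) by (apply Rmin_pos; lra).
  assert (m1 : m <= t) by apply Rmin_l. assert (m2 : m <= 1 - t) by apply Rmin_r.
  apply analytic_hol_D in Hg. apply analytic_hol_D in Hh.
  exists (fun z => RtoC m * (g z - h z))%C, z0. split; [|split; [exact Hz0|split]].
  - intros z Hz. apply hol_mult; [apply hol_const|]. apply hol_minus; auto.
  - apply Cmult_neq_0; [apply RtoC_ne0; lra|]. now apply Cminus_eq_contra.
  - intros z Hz. rewrite (E z Hz). specialize (Bg z Hz). specialize (Bh z Hz).
    assert (K : forall s, - m <= s <= m -> Cmod (RtoC (t + s) * g z + RtoC (1 - t - s) * h z) <= 1).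
    { intros s Hs. eapply Rle_trans; [apply Cmod_triangle|].
      rewrite !Cmod_mult, !Cmod_R, !Rabs_right by lra. nra. }
    assert (K1 := K m ltac:(lra)). assert (K2 := K (- m) ltac:(lra)).
    set (w := (RtoC t * g z + RtoC (1 - t) * h z)%C) in *. set (u := (RtoC m * (g z - h z))%C) in *.
    replace (RtoC (t + m) * g z + RtoC (1 - t - m) * h z)%C with (w + u)%C in K1
      by (unfold w, u; rewrite !RtoC_minus, !RtoC_plus; ring).
    replace (RtoC (t + - m) * g z + RtoC (1 - t - - m) * h z)%C with (w - u)%C in K2
      by (unfold w, u; rewrite !RtoC_minus, !RtoC_plus, !RtoC_opp; ring).
    assert (P : Cmod (w + u) ^ 2 + Cmod (w - u) ^ 2 = 2 * (Cmod w ^ 2 + Cmod u ^ 2)).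
    { rewrite !Cmod2_alt. unfold Re, Im; simpl. ring. }
    assert (Q1 := Cmod_ge_0 (w + u)). assert (Q2 := Cmod_ge_0 (w - u)). nra.
Qed.

(** * The two-term recursion with square-summable coefficients *)

(** The index n is excluded, unlike in [sum_f_R0]: the sum then counts the contributions of the
    first n steps of a recursion. *)
Fixpoint psum (u : nat -> R) (n : nat) : R :=
  match n with O => 0 | S m => psum u m + u m end.

Lemma psum_mono u n k : (forall j, 0 <= u j) -> psum u n <= psum u (n + k).
Proof.
  intros H. induction k as [|k IH]; [rewrite Nat.add_0_r; lra|].
  rewrite Nat.add_succ_r. simpl. specialize (H (n + k)%nat). lra.
Qed.

Lemma psum_ge0 u n : (forall j, 0 <= u j) -> 0 <= psum u n.
Proof. intros H. exact (psum_mono u 0 n H). Qed.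

Lemma psum_tail u M : (forall j, 0 <= u j) -> (forall n, psum u n <= M) ->
  forall eps, 0 < eps -> exists N, forall n k, (N <= n)%nat -> psum u (n + k) - psum u n < eps.
Proof.
  intros H HM eps He.
  destruct (completeness (fun x => exists n, x = psum u n)) as [L [U LL]].
  - exists M. now intros x [n ->].
  - now exists (psum u 0), 0%nat.
  - assert (X : exists N, L - eps < psum u N).
    { apply NNPP. intros C. assert (L <= L - eps); [|lra].
      apply LL. intros x [n ->]. apply Rnot_lt_le. intros D. apply C. now exists n. }
    destruct X as [N HN]. exists N. intros n k Hn.
    assert (A : psum u (n + k) <= L) by (apply U; now exists (n + k)%nat).
    assert (B := psum_mono u N (n - N) H). replace (N + (n - N))%nat with n in B by lia. lra.
Qed.

(** The loss of $y^2$ through the factor r is $1-r^2=2k$. One k is spent on the cross term,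
    $2gxy(1+r)\le4gxy\le ky^2+(4/k)(gx)^2$, and the other remains as dissipation. *)
Lemma energy_step x y x' y' g r : 0 <= x -> 0 <= y -> 0 <= g -> 0 <= r < 1 ->
  0 <= x' <= x + g * y -> 0 <= y' <= r * y + g * x ->
  let k := (1 - r * r) / 2 in
  x' ^ 2 + y' ^ 2 <= (1 + (1 + 4 / k) * g ^ 2) * (x ^ 2 + y ^ 2) - k * y ^ 2.
Proof.
  intros Hx Hy Hg Hr H1 H2 k.
  assert (Hk : 0 < k) by (unfold k; nra).
  assert (A : x' ^ 2 + y' ^ 2 <= (x + g * y) ^ 2 + (r * y + g * x) ^ 2).
  { apply Rplus_le_compat; apply pow_incr; lra. }
  eapply Rle_trans; [exact A|].
  assert (gx : 0 <= g * x) by nra.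
  assert (B : 2 * (g * x) * y * (1 + r) <= k * y ^ 2 + 4 / k * (g * x) ^ 2).
  { apply (Rmult_le_reg_l k); auto.
    replace (k * (k * y ^ 2 + 4 / k * (g * x) ^ 2)) with ((k * y) ^ 2 + 4 * (g * x) ^ 2) by (field; lra).
    assert (0 <= (k * y - 2 * (g * x)) ^ 2) by apply pow2_ge_0.
    assert (0 <= (k * y) * (g * x)) by (apply Rmult_le_pos; nra). nra. }
  assert (C : 0 <= 4 / k) by (apply Rdiv_le_0_compat; lra).
  assert (D : 0 <= 4 / k * (g * y) ^ 2) by (apply Rmult_le_pos; [auto|apply pow2_ge_0]).
  assert (E : r * r = 1 - 2 * k) by (unfold k; field).
  replace ((x + g * y) ^ 2 + (r * y + g * x) ^ 2) with
    (x ^ 2 + g ^ 2 * x ^ 2 + g ^ 2 * y ^ 2 + r * r * y ^ 2 + 2 * (g * x) * y * (1 + r)) by ring.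
  rewrite E. nra.
Qed.

Section Recursion.
Variables (g : nat -> C) (X Y : nat -> C -> C) (M r : R).
Hypothesis Hr : 0 < r < 1.
Hypothesis HM : forall n, psum (fun k => Cmod (g k) ^ 2) n <= M.
Hypothesis HX : forall n z, X (S n) z = (X n z + z * g n * Y n z)%C.
Hypothesis HY : forall n z, Y (S n) z = (z * Y n z + Cconj (g n) * X n z)%C.
Hypothesis H0 : forall z, Cmod (X 0 z) ^ 2 + Cmod (Y 0 z) ^ 2 <= 2.

Let G := psum (fun k => Cmod (g k) ^ 2).
Let E n z := Cmod (X n z) ^ 2 + Cmod (Y n z) ^ 2.
Let kap := (1 - r * r) / 2.
Let c := 1 + 4 / kap.
Let L := 2 * exp (c * M).

Lemma kap_pos : 0 < kap. Proof. unfold kap. nra. Qed.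
Lemma c_pos : 0 < c.
Proof. assert (H := kap_pos). unfold c. assert (0 < 4 / kap) by (apply Rdiv_lt_0_compat; lra). lra. Qed.

Lemma gsq_ge0 j : 0 <= Cmod (g j) ^ 2. Proof. apply pow2_ge_0. Qed.

Lemma rec_Y_le n z : Cmod z <= r -> Cmod (Y (S n) z) <= r * Cmod (Y n z) + Cmod (g n) * Cmod (X n z).
Proof.
  intros Hz. rewrite HY. eapply Rle_trans; [apply Cmod_triangle|]. rewrite !Cmod_mult, Cmod_conj.
  apply Rplus_le_compat_r. apply Rmult_le_compat_r; [apply Cmod_ge_0|auto].
Qed.

Lemma rec_dX_le n z : Cmod z <= r -> Cmod (X (S n) z - X n z) <= Cmod (g n) * Cmod (Y n z).
Proof.
  intros Hz. rewrite HX. replace (X n z + z * g n * Y n z - X n z)%C with (z * (g n * Y n z))%C by ring.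
  rewrite !Cmod_mult. assert (A := Cmod_ge_0 (g n)). assert (B := Cmod_ge_0 (Y n z)).
  assert (0 <= Cmod (g n) * Cmod (Y n z)) by nra. assert (Z := Cmod_ge_0 z). nra.
Qed.

Lemma rec_energy n z : Cmod z <= r ->
  E (S n) z <= (1 + c * Cmod (g n) ^ 2) * E n z - kap * Cmod (Y n z) ^ 2.
Proof.
  intros Hz. apply energy_step; try apply Cmod_ge_0; [lra| |].
  - split; [apply Cmod_ge_0|]. assert (A := rec_dX_le n z Hz).
    assert (B := Cmod_sub_ge (X (S n) z) (X n z)). lra.
  - split; [apply Cmod_ge_0|]. now apply rec_Y_le.
Qed.

Lemma E_ge0 n z : 0 <= E n z.
Proof. unfold E. assert (A := pow2_ge_0 (Cmod (X n z))). assert (B := pow2_ge_0 (Cmod (Y n z))). lra. Qed.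

(** Discrete Gronwall: each factor $1+t$ is at most $e^t$, and the exponents sum to at most
    [c * M]. *)
Lemma rec_energy_bound n z : Cmod z <= r -> E n z <= L.
Proof.
  intros Hz. assert (Hc := c_pos). assert (Hk := kap_pos).
  apply Rle_trans with (2 * exp (c * G n)).
  - induction n as [|n IH].
    + unfold G; simpl. rewrite Rmult_0_r, exp_0. specialize (H0 z). unfold E. lra.
    + eapply Rle_trans; [now apply rec_energy|].
      change (G (S n)) with (G n + Cmod (g n) ^ 2). rewrite Rmult_plus_distr_l, exp_plus.
      assert (A := exp_ineq1_le (c * Cmod (g n) ^ 2)).
      assert (B := gsq_ge0 n). assert (P := exp_pos (c * G n)). assert (Q := E_ge0 n z).
      assert (D := pow2_ge_0 (Cmod (Y n z))).
      assert (F : 0 <= c * Cmod (g n) ^ 2) by (apply Rmult_le_pos; lra).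
      assert (F' : 0 <= kap * Cmod (Y n z) ^ 2) by (apply Rmult_le_pos; lra).
      apply Rle_trans with ((1 + c * Cmod (g n) ^ 2) * (2 * exp (c * G n))).
      * apply Rle_trans with ((1 + c * Cmod (g n) ^ 2) * E n z); [lra|].
        apply Rmult_le_compat_l; lra.
      * replace (2 * (exp (c * G n) * exp (c * Cmod (g n) ^ 2)))
          with (exp (c * Cmod (g n) ^ 2) * (2 * exp (c * G n))) by ring.
        apply Rmult_le_compat_r; lra.
  - unfold L. apply Rmult_le_compat_l; [lra|].
    assert (A : c * G n <= c * M) by (apply Rmult_le_compat_l; [lra|apply HM]).
    destruct (Rle_lt_or_eq_dec _ _ A) as [B|B]; [left; now apply exp_increasing|rewrite B; lra].
Qed.

(** Telescoping the energy inequality, now with the uniform bound [L] on the energy. *)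
Lemma rec_dissipation z : Cmod z <= r -> forall n,
  kap * psum (fun k => Cmod (Y k z) ^ 2) n <= 2 + c * L * M.
Proof.
  intros Hz n. assert (Hc := c_pos).
  assert (LP : 0 < L) by (unfold L; generalize (exp_pos (c * M)); lra).
  assert (A : E n z + kap * psum (fun k => Cmod (Y k z) ^ 2) n <= 2 + c * L * G n).
  { induction n as [|n IH].
    - unfold G; simpl. specialize (H0 z). unfold E. lra.
    - assert (S := rec_energy n z Hz). assert (B := rec_energy_bound n z Hz). assert (D := gsq_ge0 n).
      change (G (Datatypes.S n)) with (G n + Cmod (g n) ^ 2).
      assert (F : c * Cmod (g n) ^ 2 * E n z <= c * Cmod (g n) ^ 2 * L).
      { apply Rmult_le_compat_l; auto. apply Rmult_le_pos; lra. }
      set (P := psum (fun k => Cmod (Y k z) ^ 2)) in *.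
      change (P (Datatypes.S n)) with (P n + Cmod (Y n z) ^ 2). lra. }
  assert (B := E_ge0 n z). assert (D : c * L * G n <= c * L * M).
  { apply Rmult_le_compat_l; [nra|apply HM]. } lra.
Qed.

Lemma rec_X_cauchy eps : 0 < eps -> exists N, forall n m, (N <= n)%nat -> (N <= m)%nat ->
  forall z, Cmod z <= r -> Cmod (X n z - X m z) < eps.
Proof.
  intros He. assert (Hk := kap_pos). assert (Hc := c_pos).
  assert (LP : 0 < L) by (unfold L; generalize (exp_pos (c * M)); lra).
  assert (M0 : 0 <= M) by exact (HM 0%nat).
  set (T := (2 + c * L * M) / kap).
  assert (HT : 0 < T).
  { apply Rdiv_lt_0_compat; auto. assert (0 <= c * L) by nra. nra. }
  (* AM-GM splits each increment g y into a tail of sum g^2 and a small multiple of sum y^2 *)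
  set (eta := eps / (2 * T)). assert (Heta : 0 < eta) by (apply Rdiv_lt_0_compat; lra).
  destruct (psum_tail _ M gsq_ge0 HM (eta * eps / 2)) as [N HN]; [nra|]. fold G in HN.
  assert (K : forall n k z, (N <= n)%nat -> Cmod z <= r -> Cmod (X (n + k) z - X n z) < eps).
  { intros n k z Hn Hz. set (Q := psum (fun k => Cmod (Y k z) ^ 2)).
    assert (B : Cmod (X (n + k) z - X n z) <= / eta * (G (n + k) - G n) + eta * (Q (n + k)%nat - Q n)).
    { induction k as [|k IH].
      - rewrite Nat.add_0_r. replace (X n z - X n z)%C with (RtoC 0) by ring. rewrite Cmod_0. lra.
      - rewrite Nat.add_succ_r.
        eapply Rle_trans; [apply (Cmod_sub_triangle _ (X (n + k) z))|].
        assert (A := rec_dX_le (n + k) z Hz).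
        change (G (S (n + k))) with (G (n + k) + Cmod (g (n + k)) ^ 2).
        change (Q (S (n + k))) with (Q (n + k)%nat + Cmod (Y (n + k) z) ^ 2).
        set (a := Cmod (g (n + k))) in *. set (b := Cmod (Y (n + k) z)) in *.
        assert (F : a * b <= / eta * a ^ 2 + eta * b ^ 2).
        { apply (Rmult_le_reg_l eta); auto.
          replace (eta * (/ eta * a ^ 2 + eta * b ^ 2)) with (a ^ 2 + (eta * b) ^ 2) by (field; lra).
          assert (0 <= (a - eta * b) ^ 2) by apply pow2_ge_0.
          assert (0 <= a * (eta * b)); [|nra].
          apply Rmult_le_pos; [apply Cmod_ge_0|]. apply Rmult_le_pos; [lra|apply Cmod_ge_0]. }
        lra. }
    assert (Q1 : Q (n + k)%nat <= T).
    { apply (Rmult_le_reg_l kap); auto. unfold T. replace (kap * ((2 + c * L * M) / kap)) with (2 + c * L * M) by (field; lra).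
      now apply rec_dissipation. }
    assert (Q0 : 0 <= Q n) by (apply psum_ge0; intros j; apply pow2_ge_0).
    assert (B1 : / eta * (G (n + k) - G n) < eps / 2).
    { apply (Rmult_lt_reg_l eta); auto. rewrite <- Rmult_assoc, Rinv_r, Rmult_1_l by lra.
      specialize (HN n k Hn). lra. }
    assert (B2 : eta * (Q (n + k)%nat - Q n) <= eps / 2).
    { apply Rle_trans with (eta * T); [apply Rmult_le_compat_l; lra|]. unfold eta. right. field. lra. }
    lra. }
  exists N. intros n m Hn Hm z Hz. destruct (Nat.le_ge_cases n m) as [D|D].
  - rewrite Cmod_sub_sym. replace m with (n + (m - n))%nat by lia. now apply K.
  - replace n with (m + (n - m))%nat by lia. now apply K.
Qed.

(** A bounded sum of squares alone gives convergence only pointwise. Uniformity comes from the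
    contraction by [r] with a forcing term [g n * X n] that becomes small because [g] tends to 0 and
    X is bounded. *)
Lemma rec_Y_to_0 eps : 0 < eps -> exists N, forall n, (N <= n)%nat ->
  forall z, Cmod z <= r -> Cmod (Y n z) < eps.
Proof.
  intros He. assert (LP : 0 < L) by (unfold L; generalize (exp_pos (c * M)); lra).
  assert (B : forall n z, Cmod z <= r -> Cmod (X n z) <= 1 + L /\ Cmod (Y n z) <= 1 + L).
  { intros n z Hz. assert (H := rec_energy_bound n z Hz). unfold E in H.
    assert (P1 := pow2_ge_0 (Cmod (X n z))). assert (P2 := pow2_ge_0 (Cmod (Y n z))).
    split; apply Rnot_lt_le; intros D; nra. }
  (* Chosen so that the fixed point $\eta(1+L)/(1-r)$ of the contraction equals [eps / 2]. *)
  set (eta := eps * (1 - r) / (2 * (1 + L))).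
  assert (Heta : 0 < eta) by (apply Rdiv_lt_0_compat; nra).
  destruct (psum_tail _ M gsq_ge0 HM (eta ^ 2)) as [N HN]; [nra|].
  assert (Hg : forall n, (N <= n)%nat -> Cmod (g n) <= eta).
  { intros n Hn. specialize (HN n 1%nat Hn). rewrite Nat.add_1_r in HN.
    change (psum (fun k => Cmod (g k) ^ 2) n + Cmod (g n) ^ 2 - psum (fun k => Cmod (g k) ^ 2) n < eta ^ 2) in HN.
    apply Rnot_lt_le. intros D. nra. }
  assert (K : forall k z, Cmod z <= r -> Cmod (Y (N + k) z) <= r ^ k * (1 + L) + eps / 2).
  { intros k z Hz. induction k as [|k IH].
    - rewrite Nat.add_0_r. destruct (B N z Hz). simpl. lra.
    - rewrite Nat.add_succ_r. eapply Rle_trans; [now apply rec_Y_le|].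
      destruct (B (N + k)%nat z Hz) as [B1 _].
      assert (F : Cmod (g (N + k)) * Cmod (X (N + k) z) <= eta * (1 + L)).
      { apply Rmult_le_compat; auto using Cmod_ge_0. apply Hg. lia. }
      replace (eta * (1 + L)) with (eps / 2 * (1 - r)) in F by (unfold eta; field; lra).
      simpl. nra. }
  destruct (pow_lt_1_zero r ltac:(rewrite Rabs_right; lra) (eps / (2 * (1 + L)))) as [k0 Hk0].
  { apply Rdiv_lt_0_compat; lra. }
  exists (N + k0)%nat. intros n Hn z Hz.
  specialize (K (n - N)%nat z Hz). replace (N + (n - N))%nat with n in K by lia.
  specialize (Hk0 (n - N)%nat ltac:(lia)). rewrite Rabs_right in Hk0 by (apply Rle_ge, pow_le; lra).
  apply (Rmult_lt_compat_r (1 + L)) in Hk0; [|lra].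
  replace (eps / (2 * (1 + L)) * (1 + L)) with (eps / 2) in Hk0 by (field; lra). lra.
Qed.
End Recursion.

(** * Schur polynomials *)

Definition Csum (u : nat -> C) (n : nat) : C := sum_n u n.

Lemma Csum_0 u : Csum u 0 = u 0%nat.
Proof. exact (sum_O u). Qed.

Lemma Csum_S u n : Csum u (S n) = (Csum u n + u (S n))%C.
Proof. exact (sum_Sn u n). Qed.

Lemma Csum_shift u n : Csum u (S n) = (u 0%nat + Csum (fun j => u (S j)) n)%C.
Proof.
  induction n as [|n IH]; rewrite Csum_S; [now rewrite !Csum_0|].
  rewrite IH, Csum_S. ring.
Qed.

Lemma Csum_plus u v n : Csum (fun k => u k + v k)%C n = (Csum u n + Csum v n)%C.
Proof. induction n as [|n IH]; [now rewrite !Csum_0|]. rewrite !Csum_S, IH. ring. Qed.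

Lemma Csum_scal c u n : Csum (fun k => c * u k)%C n = (c * Csum u n)%C.
Proof. induction n as [|n IH]; [now rewrite !Csum_0|]. rewrite !Csum_S, IH. ring. Qed.

Lemma Csum_ext u v n : (forall k, (k <= n)%nat -> u k = v k) -> Csum u n = Csum v n.
Proof. intros H. apply (sum_n_ext_loc (G := C_AbelianMonoid)). exact H. Qed.

Lemma pow_n_S (z : C) k : pow_n z (S k) = (z * pow_n z k)%C.
Proof. reflexivity. Qed.

Lemma poly_eval_Csum c n z : poly_eval c n z = Csum (fun k => c k * pow_n z k)%C n.
Proof. reflexivity. Qed.

Lemma poly_eval_star_Csum c n z :
  poly_eval_star c n z = Csum (fun k => Cconj (c (n - k)%nat) * pow_n z k)%C n.
Proof. reflexivity. Qed.

Lemma hol_poly_eval c n z : hol (poly_eval c n) z.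
Proof.
  assert (P : forall k, hol (fun z : C => pow_n z k : C) z).
  { intros k. induction k as [|k IH]; [exact (hol_const (RtoC 1) z)|].
    apply (hol_mult (fun z => z) (fun z : C => pow_n z k)); auto. apply hol_id. }
  induction n as [|n IH].
  - apply hol_ext with (fun z : C => c 0%nat * pow_n z 0)%C.
    + intros w. now rewrite poly_eval_Csum, Csum_0.
    + apply hol_mult; [apply hol_const|apply P].
  - apply hol_ext with (fun z : C => poly_eval c n z + c (S n) * pow_n z (S n))%C.
    + intros w. now rewrite !poly_eval_Csum, Csum_S.
    + apply hol_plus; auto. apply hol_mult; [apply hol_const|apply P].
Qed.

(** The common pattern of both components of [schur_coefs], with the roles of A and B exchanged. *)
Definition coef_update (g : C) (m : nat) (a b : nat -> C) : nat -> C :=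
  fun k => match k with
           | O => a O
           | S _ => if Nat.leb k (S m) then Cplus (a k) (Cmult g (Cconj (b (S m - k)%nat))) else a k
           end.

Lemma poly_eval_update g m a b z : a (S m) = RtoC 0 ->
  poly_eval (coef_update g m a b) (S m) z = (poly_eval a m z + z * g * poly_eval_star b m z)%C.
Proof.
  intros Ha. rewrite !poly_eval_Csum, poly_eval_star_Csum, <- Csum_scal, Csum_shift.
  rewrite (Csum_ext _ (fun j => a (S j) * pow_n z (S j) + z * g * (Cconj (b (m - j)%nat) * pow_n z j))%C).
  - rewrite Csum_plus, Cplus_assoc, <- (Csum_shift (fun k => a k * pow_n z k)%C), Csum_S, Ha. ring.
  - intros k Hk. unfold coef_update.
    replace (Nat.leb (S k) (S m)) with true by (symmetry; apply Nat.leb_le; lia).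
    replace (S m - S k)%nat with (m - k)%nat by lia. rewrite pow_n_S. ring.
Qed.

(** Raising the degree of reversal by one multiplies $a^*$ by z, and reverses $zgb^*$ back to $\bar
    g b$. *)
Lemma poly_eval_star_update g m a b z : a (S m) = RtoC 0 ->
  poly_eval_star (coef_update g m a b) (S m) z =
  (z * poly_eval_star a m z + Cconj g * poly_eval b m z)%C.
Proof.
  intros Ha. rewrite !poly_eval_star_Csum, poly_eval_Csum, <- !Csum_scal, Csum_S.
  rewrite (Csum_ext _ (fun k => Cconj (a (S m - k)%nat) * pow_n z k + Cconj g * (b k * pow_n z k))%C).
  - rewrite Csum_plus, Nat.sub_diag. simpl coef_update.
    set (s2 := Csum (fun k => Cconj g * (b k * pow_n z k))%C m).
    transitivity (Csum (fun k => Cconj (a (S m - k)%nat) * pow_n z k)%C (S m) + s2)%C.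
    + rewrite Csum_S, Nat.sub_diag. ring.
    + f_equal. rewrite Csum_shift, Nat.sub_0_r, Ha.
      replace (Cconj 0) with (RtoC 0) by (apply injective_projections; simpl; ring).
      rewrite Cmult_0_l, Cplus_0_l. apply Csum_ext. intros k Hk.
      replace (S m - S k)%nat with (m - k)%nat by lia. rewrite pow_n_S. ring.
  - intros k Hk. replace (S m - k)%nat with (S (m - k)) by lia. unfold coef_update.
    replace (Nat.leb (S (m - k)) (S m)) with true by (symmetry; apply Nat.leb_le; lia).
    replace (S m - S (m - k))%nat with k by lia.
    rewrite Cplus_conj, Cmult_conj, Cconj_conj. ring.
Qed.

Section SchurPolynomials.
Variable f : C -> C.

Lemma schur_coefs_S m : schur_coefs f (S m) =
  (coef_update (schur_gamma f (S m)) m (fst (schur_coefs f m)) (snd (schur_coefs f m)),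
   coef_update (schur_gamma f (S m)) m (snd (schur_coefs f m)) (fst (schur_coefs f m))).
Proof. simpl schur_coefs at 1. destruct (schur_coefs f m) as [a b]. reflexivity. Qed.

Lemma schur_coefs_support n k : (n < k)%nat ->
  fst (schur_coefs f n) k = RtoC 0 /\ snd (schur_coefs f n) k = RtoC 0.
Proof.
  revert k. induction n as [|n IH]; intros k Hk.
  - destruct k; [lia|]. now split.
  - rewrite schur_coefs_S. simpl fst. simpl snd. unfold coef_update.
    destruct k as [|k]; [lia|].
    replace (Nat.leb (S k) (S n)) with false by (symmetry; apply Nat.leb_gt; lia).
    apply IH. lia.
Qed.

Lemma schurA_S n z : schurA f (S n) z = (schurA f n z + z * schur_gamma f (S n) * schurB_star f n z)%C.
Proof. unfold schurA, schurB_star. rewrite schur_coefs_S. apply poly_eval_update, schur_coefs_support. lia. Qed.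

Lemma schurB_S n z : schurB f (S n) z = (schurB f n z + z * schur_gamma f (S n) * schurA_star f n z)%C.
Proof. unfold schurB, schurA_star. rewrite schur_coefs_S. apply poly_eval_update, schur_coefs_support. lia. Qed.

Lemma schurA_star_S n z :
  schurA_star f (S n) z = (z * schurA_star f n z + Cconj (schur_gamma f (S n)) * schurB f n z)%C.
Proof. unfold schurA_star, schurB. rewrite schur_coefs_S. apply poly_eval_star_update, schur_coefs_support. lia. Qed.

Lemma schurB_star_S n z :
  schurB_star f (S n) z = (z * schurB_star f n z + Cconj (schur_gamma f (S n)) * schurA f n z)%C.
Proof. unfold schurB_star, schurA. rewrite schur_coefs_S. apply poly_eval_star_update, schur_coefs_support. lia. Qed.

Lemma schur_poly_0 z : schurA f 0 z = schur_gamma f 0 /\ schurB f 0 z = RtoC 1 /\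
  schurA_star f 0 z = Cconj (schur_gamma f 0) /\ schurB_star f 0 z = RtoC 1.
Proof.
  unfold schurA, schurB, schurA_star, schurB_star.
  rewrite !poly_eval_Csum, !poly_eval_star_Csum, !Csum_0. simpl schur_coefs. simpl fst. simpl snd.
  change (pow_n z 0) with (RtoC 1).
  replace (Cconj 1) with (RtoC 1) by (apply injective_projections; simpl; ring).
  rewrite !Cmult_1_r. auto.
Qed.

Hypothesis Hs : forall n, hol_D (schur_iter f n) /\ bounded_by_1 (schur_iter f n) /\ Cmod (schur_gamma f n) < 1.

(** By induction both sides at n+1 become multiples of $D=B_n^*-fA_n^*$: the left is $z(w-g)D$, the
    right $z^2v(1-\bar g w)D$, and they agree by the Schur step from $w=f_{n+1}(z)$ to
    $v=f_{n+2}(z)$. *)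
Lemma schur_remainder n z : Cmod z < 1 ->
  (f z * schurB f n z - schurA f n z)%C =
  (z * schur_iter f (S n) z * (schurB_star f n z - f z * schurA_star f n z))%C.
Proof.
  intros Hz. induction n as [|n IH].
  - destruct (schur_poly_0 z) as (-> & -> & -> & ->).
    destruct (Hs 0) as (H1 & H2 & H3). unfold schur_gamma in *.
    assert (E := schur_step_eq f H2 H3 z Hz). simpl schur_iter in *.
    rewrite Cmult_1_r, E. ring.
  - rewrite schurA_S, schurB_S, schurA_star_S, schurB_star_S.
    destruct (Hs (S n)) as (H1 & H2 & H3).
    assert (E := schur_step_eq _ H2 H3 z Hz).
    change (schur_step (schur_iter f (S n))) with (schur_iter f (S (S n))) in E.
    change (schur_iter f (S n) (RtoC 0)) with (schur_gamma f (S n)) in E.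
    set (g := schur_gamma f (S n)) in *. set (w := schur_iter f (S n) z) in *.
    set (v := schur_iter f (S (S n)) z) in *.
    set (A := schurA f n z) in *. set (B := schurB f n z) in *.
    set (A' := schurA_star f n z) in *. set (B' := schurB_star f n z) in *.
    transitivity ((f z * B - A) - z * g * (B' - f z * A'))%C; [ring|].
    transitivity (z * v * (z * (B' - f z * A') - Cconj g * (f z * B - A)))%C; [|ring].
    rewrite IH.
    transitivity (z * (B' - f z * A') * (w - g))%C; [ring|]. rewrite E. ring.
Qed.
End SchurPolynomials.

(** * From closed discs to compact sets, and the theorem *)

Lemma compact_in_disc K : compact_C K -> (forall z, K z -> inD z) ->
  exists r, 0 < r < 1 /\ forall z, K z -> Cmod z <= r.
Proof.
  intros HK HD.
  (* Increasing discs, so a finite subcover has a largest one; the shift by 2 keeps every radius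
     positive, even for empty [K]. *)
  destruct (HK nat (fun n z => Cmod z < 1 - / (INR n + 2))) as [l Hl].
  - intros n z Hz. exists (1 - / (INR n + 2) - Cmod z). split; [lra|]. intros w Hw.
    replace w with (z + (w - z))%C by ring. eapply Rle_lt_trans; [apply Cmod_triangle|lra].
  - intros z Hz. specialize (HD z Hz). unfold inD in HD.
    destruct (archimed_cor1 (1 - Cmod z)) as (n & Hn & Hn'); [lra|].
    exists n. assert (0 < INR n) by (apply lt_0_INR; lia).
    assert (/ (INR n + 2) < / INR n) by (apply Rinv_lt_contravar; nra). lra.
  - assert (Q : exists m, forall n, In n l -> (n <= m)%nat).
    { clear. induction l as [|a l [m IH]]; [now exists 0%nat|].
      exists (Nat.max a m). intros n [->|H]; [lia|]. specialize (IH n H). lia. }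
    destruct Q as [m Hm]. assert (P := pos_INR m).
    exists (1 - / (INR m + 2)).
    assert (/ (INR m + 2) < 1) by (rewrite <- Rinv_1; apply Rinv_lt_contravar; lra).
    assert (0 < / (INR m + 2)) by (apply Rinv_0_lt_compat; lra).
    split; [lra|]. intros z Hz. destruct (Hl z Hz) as (n & Hn & L).
    apply Hm, le_INR in Hn. assert (P' := pos_INR n).
    assert (/ (INR m + 2) <= / (INR n + 2)) by (apply Rinv_le_contravar; lra). lra.
Qed.

Lemma disc_unif_lim_loc F g : disc_unif_lim F g -> loc_unif_cvg_D F g.
Proof.
  intros H K HK HD eps He. destruct (compact_in_disc K HK HD) as (r & Hr & L).
  destruct (H r eps Hr He) as [N HN]. exists N. intros n Hn z Hz. apply HN; auto.
Qed.

Lemma psum_shift_le u n : 0 <= u 0%nat -> psum (fun k => u (S k)) n <= sum_f_R0 u n.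
Proof.
  intros H. induction n as [|n IH]; simpl in *; lra.
Qed.

Theorem theorem10 (f : C -> C) :
  in_B f -> ~ extreme_B f ->
  exists a b : C -> C,
    analytic_on_D a /\ analytic_on_D b /\
    loc_unif_cvg_D (schurA f) a /\ loc_unif_cvg_D (schurB f) b /\
    (forall z : C, inD z -> a z = Cmult (b z) (f z)) /\
    loc_unif_cvg_D (schurA_star f) (fun _ => RtoC 0) /\
    loc_unif_cvg_D (schurB_star f) (fun _ => RtoC 0).
Proof.
  intros HB HE.
  destruct (nonextreme_companion f HB HE) as (U & z0 & HU & Hz0 & U0 & HfU).
  assert (Hf : hol_D f) by (apply analytic_hol_D, HB).
  destruct (schur_square_summable f U z0 Hf HU HfU Hz0 U0) as [Hs [M HM]].
  (* The passage from n to n+1 uses the parameter of index n+1; gamma_0 enters only the starting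
     values. *)
  set (g := fun n => schur_gamma f (S n)).
  assert (HM' : forall n, psum (fun k => Cmod (g k) ^ 2) n <= M).
  { intros n. eapply Rle_trans; [apply (psum_shift_le (fun k => Cmod (schur_gamma f k) ^ 2))|apply HM].
    apply pow2_ge_0. }
  (* The same bound covers both starting pairs, whose moduli are $|\gamma_0|$ and 1 in either
     order. *)
  assert (g0 : Cmod (schur_gamma f 0) ^ 2 + 1 ^ 2 <= 2).
  { destruct (Hs 0%nat) as (_ & _ & L). assert (P := Cmod_ge_0 (schur_gamma f 0)). nra. }
  assert (IA : forall z, Cmod (schurA f 0 z) ^ 2 + Cmod (schurB_star f 0 z) ^ 2 <= 2).
  { intros z. destruct (schur_poly_0 f z) as (-> & _ & _ & ->). rewrite Cmod_1. lra. }
  assert (IB : forall z, Cmod (schurB f 0 z) ^ 2 + Cmod (schurA_star f 0 z) ^ 2 <= 2).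
  { intros z. destruct (schur_poly_0 f z) as (_ & -> & -> & _). rewrite Cmod_1, Cmod_conj. lra. }
  destruct (disc_unif_cauchy_lim (schurA f)) as [a Ha].
  { intros r eps Hr He.
    exact (rec_X_cauchy g _ _ M r Hr HM' (schurA_S f) (schurB_star_S f) IA eps He). }
  destruct (disc_unif_cauchy_lim (schurB f)) as [b Hb].
  { intros r eps Hr He.
    exact (rec_X_cauchy g _ _ M r Hr HM' (schurB_S f) (schurA_star_S f) IB eps He). }
  assert (sA : disc_unif_lim (schurA_star f) (fun _ => RtoC 0)).
  { intros r eps Hr He.
    destruct (rec_Y_to_0 g _ _ M r Hr HM' (schurB_S f) (schurA_star_S f) IB eps He) as [N HN].
    exists N. intros n Hn z Hz. replace (schurA_star f n z - 0)%C with (schurA_star f n z) by ring. auto. }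
  assert (sB : disc_unif_lim (schurB_star f) (fun _ => RtoC 0)).
  { intros r eps Hr He.
    destruct (rec_Y_to_0 g _ _ M r Hr HM' (schurA_S f) (schurB_star_S f) IA eps He) as [N HN].
    exists N. intros n Hn z Hz. replace (schurB_star f n z - 0)%C with (schurB_star f n z) by ring. auto. }
  exists a, b.
  split. { apply analytic_hol_D, (disc_unif_lim_hol (schurA f)); auto. intros n z _. apply hol_poly_eval. }
  split. { apply analytic_hol_D, (disc_unif_lim_hol (schurB f)); auto. intros n z _. apply hol_poly_eval. }
  split; [now apply disc_unif_lim_loc|]. split; [now apply disc_unif_lim_loc|].
  split; [|split; now apply disc_unif_lim_loc].
  intros z Hz. unfold inD in Hz. assert (Z := Cmod_ge_0 z).
  apply Ceq_of_small. intros eps He.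
  set (r := (1 + Cmod z) / 2). assert (Hr : 0 < r < 1) by (unfold r; lra).
  assert (Hzr : Cmod z <= r) by (unfold r; lra).
  destruct (Ha r (eps / 4) Hr ltac:(lra)) as [N1 K1]. destruct (Hb r (eps / 4) Hr ltac:(lra)) as [N2 K2].
  destruct (sA r (eps / 4) Hr ltac:(lra)) as [N3 K3]. destruct (sB r (eps / 4) Hr ltac:(lra)) as [N4 K4].
  set (n := (N1 + (N2 + (N3 + N4)))%nat).
  specialize (K1 n ltac:(unfold n; lia) z Hzr). specialize (K2 n ltac:(unfold n; lia) z Hzr).
  specialize (K3 n ltac:(unfold n; lia) z Hzr). specialize (K4 n ltac:(unfold n; lia) z Hzr).
  replace (schurA_star f n z - 0)%C with (schurA_star f n z) in K3 by ring.
  replace (schurB_star f n z - 0)%C with (schurB_star f n z) in K4 by ring.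
  assert (E := schur_remainder f Hs n z Hz).
  assert (F1 : Cmod (f z) <= 1) by (destruct (Hs 0%nat) as (_ & B & _); now apply B).
  assert (Fn : Cmod (schur_iter f (S n) z) <= 1) by (destruct (Hs (S n)) as (_ & B & _); now apply B).
  (* In the remainder formula $|zf_{n+1}|\le1$, so the small reversed polynomials decide. *)
  assert (R1 : Cmod (f z * schurB f n z - schurA f n z) <= eps / 2).
  { rewrite E, !Cmod_mult.
    assert (D : Cmod (schurB_star f n z - f z * schurA_star f n z) <= eps / 2).
    { eapply Rle_trans; [apply Cmod_sub_le|]. rewrite Cmod_mult.
      assert (P := Cmod_ge_0 (schurA_star f n z)). assert (P' := Cmod_ge_0 (f z)). nra. }
    assert (P := Cmod_ge_0 (schur_iter f (S n) z)).
    assert (P' := Cmod_ge_0 (schurB_star f n z - f z * schurA_star f n z)).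
    assert (Cmod z * Cmod (schur_iter f (S n) z) <= 1) by nra.
    assert (0 <= Cmod z * Cmod (schur_iter f (S n) z)) by nra. nra. }
  (* The three pieces contribute at most [eps / 4], [eps / 4] and [eps / 2]. *)
  replace (a z - b z * f z)%C with
    (- (schurA f n z - a z) + (f z * (schurB f n z - b z) - (f z * schurB f n z - schurA f n z)))%C by ring.
  eapply Rle_trans; [apply Cmod_triangle|]. rewrite Cmod_opp.
  assert (T := Cmod_sub_le (f z * (schurB f n z - b z)) (f z * schurB f n z - schurA f n z)).
  rewrite Cmod_mult in T. assert (P := Cmod_ge_0 (schurB f n z - b z)).
  assert (Cmod (f z) * Cmod (schurB f n z - b z) <= Cmod (schurB f n z - b z)) by nra. lra.
Qed.
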